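(* Let $d\ge 2$, $D=\{1,\dots,d\}$, let $B\subset D$ with $|B|>1$, $B'=D\setminus B$, and let $L_Q(\mathbb{I}^d)$ be an Orlicz space such that $$L_Q(\mathbb{I}^d)\not\subseteq L\log^{|B|-1}L(\mathbb{I}^d).$$ Then the set of functions $f\in L_Q(\mathbb{I}^d)$ for which the logarithmic means $(L_{n_B}\circ R_{n_{B'}})(f)$ of the rectangular partial sums of the multiple Walsh-Fourier series of $f$ converge in measure on $\mathbb{I}^d$ (to some a.e. finite measurable function, as $n_i\to\infty$ for all $i\in D$, i.e. as $\min_{i\in D}n_i\to\infty$) is of first Baire category in $L_Q(\mathbb{I}^d)$.
   Context: $\mathbb{I}^d=[0,1)^d$ with Lebesgue measure; functions on $\mathbb{I}^d$ are identified with their $1$-periodic extensions in each variable. $|B|$ is the number of elements of $B$. Walsh system: $r_0(x)=1$ for $x\in[0,1/2)$, $r_0(x)=-1$ for $x\in[1/2,1)$, extended $1$-periodically; $r_n(x)=r_0(2^nx)$. $w_0=1$, and if $n=2^{m_1}+\dots+2^{m_s}$ with $m_1>\dots>m_s\ge 0$, then $w_n=r_{m_1}\cdots r_{m_s}$. For $f\in L_1(\mathbb{I}^d)$ put $\widehat f(j_1,\dots,j_d)=\int_{\mathbb{I}^d}f(\mathbf{x})\prod_{i=1}^d w_{j_i}(x_i)\,d\mathbf{x}$, and for positive integers $N_1,\dots,N_d$ define the rectangular partial sum $$S_{N_1,\dots,N_d}(f;\mathbf{x})=\sum_{j_1=0}^{N_1-1}\cdots\sum_{j_d=0}^{N_d-1}\widehat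 f(j_1,\dots,j_d)\prod_{i=1}^d w_{j_i}(x_i).$$ Mixed logarithmic means: with $l_n=\sum_{k=1}^{n-1}\frac1k$, for integers $n_1,\dots,n_d\ge2$, $$(L_{n_B}\circ R_{n_{B'}})(f;\mathbf{x})=\frac{1}{\prod_{j\in D}l_{n_j}}\sum_{i_1=1}^{n_1-1}\cdots\sum_{i_d=1}^{n_d-1}\frac{S_{N_1,\dots,N_d}(f;\mathbf{x})}{i_1i_2\cdots i_d},\qquad N_j=n_j-i_j\ (j\in B),\quad N_j=i_j\ (j\in B').$$ Orlicz spaces: a Young function is a convex continuous even function $Q$ with $Q(0)=0$, $\lim_{u\to+\infty}Q(u)/u=+\infty$ and $\lim_{u\to0}Q(u)/u=0$. The Orlicz space $L_Q(\mathbb{I}^d)$ generated by a Young function $Q$ consists of the measurable functions with finite norm $\Vert f\Vert_{L_Q(\mathbb{I}^d)}=\inf\{k>0:\int_{\mathbb{I}^d}Q(|f|/k)\le1\}$. For $\beta>0$, $L\log^\beta L(\mathbb{I}^d)$ is the Orlicz space generated by $Q(u)=u\log^\beta(1+u)$, $u\ge0$ (extended evenly). *)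

(* Defs.v *)
From HB Require Import structures.
From mathcomp Require Import all_boot all_order all_algebra.
From mathcomp Require Import all_classical all_reals all_analysis.
From mathcomp Require Import measurable_realfun.

Set Implicit Arguments.
Unset Strict Implicit.
Unset Printing Implicit Defensive.

Import Order.TTheory GRing.Theory Num.Theory.
Import numFieldNormedType.Exports.

Local Open Scope classical_set_scope.
Local Open Scope ring_scope.

(* [lebesgue_measure] lives on the copy [measurableTypeR R] of [R]. *)
Notation euclid R n := (n.-tuple (measurableTypeR R)).

Section lebesgue_tuple.
Context {R : realType}.

Definition tuple_consr n (p : euclid R n * measurableTypeR R) : euclid R n.+1 :=
  [tuple of p.2 :: p.1].

Lemma measurable_tuple_consr n : measurable_fun setT (@tuple_consr n).
Proof. exact: measurable_cons. Qed.

Definition lebesgue_tupleS n (m : {measure set (euclid R n) -> \bar R}) :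
  {measure set (euclid R n.+1) -> \bar R}.
Proof.
refine [the {measure set (euclid R n.+1) -> \bar R} of
  pushforward (m \x (@lebesgue_measure R))%E (@tuple_consr n)].
exact: measurable_tuple_consr.
Defined.

(* n-dimensional Lebesgue measure on the Borel sets, characterised by
   [lebesgue_tuple_box] below. *)
Fixpoint lebesgue_tuple n : {measure set (euclid R n) -> \bar R} :=
  if n is n'.+1 then lebesgue_tupleS (lebesgue_tuple n')
  else [the {measure set (euclid R 0) -> \bar R} of dirac [tuple]].

Definition box n (A : 'I_n -> set (measurableTypeR R)) : set (euclid R n) :=
  [set x | forall i, A i (tnth x i)].

Lemma measurable_box n (A : 'I_n -> set (measurableTypeR R)) :
  (forall i, measurable (A i)) -> measurable (box A).
Proof.
move=> mA.
have -> : box A = \big[setI/setT]_(i < n) ((fun x => tnth x i) @^-1` A i).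
  rewrite -bigcap_seq/=; apply/seteqP; split => [x Ax i _|x Ax i]; first exact: Ax.
  by apply: (Ax i); rewrite /= mem_index_enum.
apply: bigsetI_measurable => i _; rewrite -[X in measurable X]setTI.
exact: measurable_tnth.
Qed.

Lemma lebesgue_tuple_box n (A : 'I_n -> set (measurableTypeR R)) :
  (forall i, measurable (A i)) ->
  lebesgue_tuple n (box A) = (\prod_(i < n) lebesgue_measure (A i))%E.
Proof.
elim: n A => [|n IH] A mA.
  rewrite big_ord0 /= diracE mem_set// => -[]//.
rewrite big_ord_recl /= /pushforward.
have -> : @tuple_consr n @^-1` box A =
    box (fun i => A (lift ord0 i)) `*` A ord0.
  apply/seteqP; split => [[x y] /= Axy|[x y] /= [Ax Ay] i].
    by split => [i|]; [have := Axy (lift ord0 i); rewrite tnthS|exact: (Axy ord0)].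
  by case: (unliftP ord0 i) => [j ->|->//]; rewrite tnthS; exact: Ax.
rewrite product_measure1E//; last by apply: measurable_box => i; exact: mA.
by rewrite IH 1?muleC.
Qed.

Definition unit_cube d : set (euclid R d) := box (fun=> [set` `[0 : R, 1[]).
End lebesgue_tuple.
Arguments lebesgue_tuple : clear implicits.
Arguments unit_cube : clear implicits.

Section orlicz_space.
Context {R : realType}.

Record young_function (Q : R -> R) : Prop := YoungFunction {
  young_convex : convex_function [set: R^o] (Q : R^o -> R^o) ;
  young_continuous : continuous Q ;
  young_even : forall u, Q (- u) = Q u ;
  young0 : Q 0 = 0 ;
  young_superlinear : Q u / u @[u --> +oo] --> +oo ;
  young_sublinear0 : Q u / u @[u --> 0^'] --> 0 }.

Definition luxemburg_norm d (Q : R -> R) (f : euclid R d -> R) : \bar R :=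
  ereal_inf [set k%:E | k in [set k : R | 0 < k /\
    (\int[lebesgue_tuple R d]_(x in unit_cube R d)
       (Q (`|f x| / k))%:E <= 1)%E]].

(* Only the values of [f] on the unit cube matter. *)
Definition orlicz_space d (Q : R -> R) : set (euclid R d -> R) :=
  [set f | measurable_fun (unit_cube R d) f /\
           (luxemburg_norm Q f < +oo)%E].

Definition LlogL (beta u : R) : R := `|u| * ln (1 + `|u|) `^ beta.

Record orlicz d (Q : R -> R) := Orlicz {
  orlicz_fun :> euclid R d -> R ;
  orlicz_funP : orlicz_space Q orlicz_fun }.

HB.instance Definition _ d Q := gen_eqMixin (orlicz d Q).
HB.instance Definition _ d Q := gen_choiceMixin (orlicz d Q).

Section orlicz_topology.
Variables (d : nat) (Q : R -> R).

Definition orlicz_ball (f : orlicz d Q) (e : R) : set (orlicz d Q) :=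
  [set g | (luxemburg_norm Q (fun x => g x - f x)%R < e%:E)%E].

Definition orlicz_open : set_system (orlicz d Q) :=
  [set U | forall f, U f -> exists2 e : R, 0 < e & orlicz_ball f e `<=` U].

Let orlicz_openT : orlicz_open setT.
Proof. by move=> f _; exists 1. Qed.

Let orlicz_openI : setI_closed orlicz_open.
Proof.
move=> U V oU oV f [/oU[e e0 eU] /oV[e' e'0 e'V]].
exists (Num.min e e'); first by rewrite lt_min e0.
move=> g fg; split; [apply: eU|apply: e'V]; apply: (lt_le_trans fg);
  by rewrite lee_fin ge_min lexx ?orbT.
Qed.

Let orlicz_open_bigU (I : Type) (F : I -> set (orlicz d Q)) :
  (forall i, orlicz_open (F i)) -> orlicz_open (\bigcup_i F i).
Proof.
move=> oF f [i _ /oF[e e0 eF]]; exists e => // g /eF Fg; by exists i.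
Qed.

(* The topology of the Luxemburg norm. Functions equal a.e. are not
   identified, so this topology is not Hausdorff. *)
HB.instance Definition _ := isOpenTopological.Build (orlicz d Q)
  orlicz_openT orlicz_openI orlicz_open_bigU.

End orlicz_topology.
End orlicz_space.
Arguments orlicz_space {R} d Q.

Definition nowhere_dense (T : topologicalType) (A : set T) : Prop :=
  (closure A)° = set0.

Definition first_category (T : topologicalType) (A : set T) : Prop :=
  exists F : (set T)^nat, (forall k, nowhere_dense (F k)) /\ A = \bigcup_k F k.

Section walsh.
Context {R : realType}.

Definition rademacher (n : nat) (x : R) : R :=
  let y := 2 ^+ n * x in
  if y - (Num.floor y)%:~R < 2^-1 then 1 else -1.

(* [odd (n %/ 2 ^ m)] is the m-th binary digit of [n]; it vanishes for
   m >= n. *)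
Definition walsh (n : nat) (x : R) : R :=
  \prod_(m < n | odd (n %/ 2 ^ m)%N) rademacher m x.

Definition walsh_tensor d (j : 'I_d -> nat) (x : euclid R d) : R :=
  \prod_(i < d) walsh (j i) (tnth x i).

Definition walsh_coef d (f : euclid R d -> R) (j : 'I_d -> nat) : R :=
  \int[lebesgue_tuple R d]_(x in unit_cube R d) (f x * walsh_tensor j x).

Definition rect_sum d (f : euclid R d -> R) (N : 'I_d -> nat)
    (x : euclid R d) : R :=
  \sum_(j : {dffun forall i : 'I_d, 'I_(N i)})
    walsh_coef f (fun i => j i : nat) * walsh_tensor (fun i => j i : nat) x.

Definition log_weight (n : nat) : R := \sum_(1 <= k < n) k%:R^-1.

(* The Noerlund logarithmic mean in the variables of [B], the Riesz
   logarithmic mean in the others. *)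
Definition log_mean d (B : {set 'I_d}) (f : euclid R d -> R)
    (n : 'I_d -> nat) (x : euclid R d) : R :=
  (\prod_(j < d) log_weight (n j))^-1 *
  \sum_(i : {dffun forall j : 'I_d, 'I_(n j)} | [forall j, (0 < i j)%N])
    rect_sum f (fun j => if j \in B then (n j - i j)%N else i j) x /
    \prod_(j < d) (i j)%:R.

End walsh.

Section convergence_in_measure.
Context {R : realType} (d : nat).

Definition min_pinfty : set_system ('I_d -> nat) :=
  filter_from [set: nat] (fun M => [set n | forall i, (M <= n i)%N]).

Definition cvg_in_measure_to (F : ('I_d -> nat) -> euclid R d -> R)
    (g : euclid R d -> \bar R) : Prop :=
  forall e : R, 0 < e ->
    lebesgue_tuple R d
      (unit_cube R d `&` [set x | e%:E < `|(F n x)%:E - g x|]%E)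
      @[n --> min_pinfty] --> 0%E.

Definition cvg_in_measure (F : ('I_d -> nat) -> euclid R d -> R) : Prop :=
  exists g : euclid R d -> \bar R,
    [/\ measurable_fun (unit_cube R d) g,
        {ae lebesgue_tuple R d,
          forall x, unit_cube R d x -> g x \is a fin_num}
      & cvg_in_measure_to F g].

End convergence_in_measure.

(* Main.v *)
Require Import Defs.
From mathcomp Require Import all_boot all_order all_algebra.
From mathcomp Require Import all_classical all_reals all_analysis.
From mathcomp Require Import measurable_realfun.
From mathcomp Require Import zify ring lra.

(** Let [k = #|B|].  By a Baire category argument it suffices to find, for every
    threshold, functions [xi] in the unit ball of [L_Q] and arbitrarily large [n] such
    that the mean of [xi] exceeds the threshold on a set of measure at least [1/4].

    For [n = 2 ^ m %/ 3] the one-dimensional Noerlund logarithmic kernel is of order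
    [1 / x] for [x] in a range of the form [2 ^ - m <= x <= 2 ^ (c m - m)]: there
    [D_(n - j) x] has a sign independent of [j] and is of order [1 / x] as long as [j] stays below
    the residue of [n] modulo [1 / x], and these [j] carry most of the logarithmic weight.
    Hence the product kernel in the variables of [B] exceeds [2 ^ (k m - L)] on a set of
    measure about [L ^ (k - 1) * 2 ^ (L - k m)].  A greedy choice of translates makes these
    sets cover half of the cube, and random signs prevent cancellation between the
    translates.  The resulting function takes the values [0], [u] and [- u] with
    [u ~ 2 ^ L], and lies in the unit ball as soon as [Q u <= c u (ln u) ^ (k - 1)]
    for a small [c]; such [u] exist because [L_Q] is not contained in [L log^(k - 1) L].
    Everything lives on dyadic cells, which are encoded by vectors of bits. *)

Set Implicit Arguments.
Unset Strict Implicit.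
Unset Printing Implicit Defensive.

Import Order.TTheory GRing.Theory Num.Theory.
Import numFieldNormedType.Exports.

Local Open Scope ring_scope.

(** * Lower bound for the Noerlund logarithmic kernel *)

Section sign_characters.
Context {R : realFieldType}.
Implicit Types (rho : nat -> R) (m s q t N : nat).

(** The Walsh function of index [N < 2 ^ m], expressed through the values [rho i] of the Rademacher
    functions at a point; [dirichlet] is then the Walsh-Dirichlet kernel at that point. *)
Definition sign_char m rho N : R := \prod_(i < m | odd (N %/ 2 ^ i)) rho i.

Definition dirichlet m rho N : R := \sum_(0 <= j < N) sign_char m rho j.

(** Digits below [s] contribute factors 1, digits above [s] are not affected by [t], and the digit
    [s] is set exactly when [2 ^ s <= t]. *)
Lemma sign_char_block m rho s q t : (s < m)%N ->
  (forall i, (i < s)%N -> rho i = 1) -> rho s = -1 -> (t < 2 ^ s.+1)%N ->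
  sign_char m rho (2 ^ s.+1 * q + t) =
  sign_char m rho (2 ^ s.+1 * q) * (-1) ^+ (2 ^ s <= t)%N.
Proof.
move=> sm rho1 rhos tM.
have Dle i : (i <= s)%N -> ((2 ^ s.+1 * q + t) %/ 2 ^ i = 2 ^ (s.+1 - i) * q + t %/ 2 ^ i)%N.
  move=> lis; have -> : (2 ^ s.+1 * q = (2 ^ (s.+1 - i) * q) * 2 ^ i)%N.
    by rewrite mulnAC -expnD subnK// ltnW.
  by rewrite divnMDl// expn_gt0.
have Dgt i : (s < i)%N -> ((2 ^ s.+1 * q + t) %/ 2 ^ i = (2 ^ s.+1 * q) %/ 2 ^ i)%N.
  move=> si; rewrite -[in LHS](subnKC si) -[in RHS](subnKC si) expnD !divnMA.
  by rewrite [(_ * q)%N]mulnC divnMDl ?expn_gt0// (divn_small tM) addn0 mulnK ?expn_gt0.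
rewrite /sign_char ![in LHS]big_mkcond ![in RHS]big_mkcond /=.
rewrite (bigD1 (Ordinal sm))//= [in RHS](bigD1 (Ordinal sm))//= mulrAC.
congr (_ * _); last first.
  apply: eq_bigr => i; rewrite -val_eqE/= => /eqP is_.
  have [lis|lsi] := ltnP i s; first by rewrite rho1// !if_same.
  by rewrite Dgt// ltn_neqAle lsi andbT eq_sym; apply/eqP.
have D0 : ((2 ^ s.+1 * q) %/ 2 ^ s = 2 * q)%N.
  by rewrite expnS mulnAC mulnK ?expn_gt0.
rewrite Dle// D0 subSnn expn1 oddD !oddM/= mul1r rhos.
have [le|lt] := leqP; last by rewrite divn_small.
have -> : (t %/ 2 ^ s)%N = 1%N; last by rewrite expr1.
rewrite -(subnKC le) -{1}(mul1n (2 ^ s)%N) divnMDl ?expn_gt0// divn_small//.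
by move: tM; rewrite expnS; lia.
Qed.

(** A block of length [2 ^ s.+1] consists of [2 ^ s] equal signs followed by as many opposite ones.
    Full blocks cancel, and the partial sums inside a block form a tent of height [2 ^ s]. *)
Lemma dirichlet_block m rho s q t : (s < m)%N ->
  (forall i, (i < s)%N -> rho i = 1) -> rho s = -1 -> (t <= 2 ^ s.+1)%N ->
  dirichlet m rho (2 ^ s.+1 * q + t) =
  sign_char m rho (2 ^ s.+1 * q) * (minn t (2 ^ s.+1 - t))%:R.
Proof.
move=> sm rho1 rhos.
have E : forall q' t', (t' <= 2 ^ s.+1)%N ->
    dirichlet m rho (2 ^ s.+1 * q' + t') = dirichlet m rho (2 ^ s.+1 * q') +
      sign_char m rho (2 ^ s.+1 * q') * (minn t' (2 ^ s.+1 - t'))%:R.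
  move=> q'; elim=> [|t' IH] tM; first by rewrite addn0 min0n mulr0 addr0.
  rewrite addnS {1}/dirichlet big_nat_recr//= -/(dirichlet _ _ _) IH 1?ltnW//.
  rewrite (sign_char_block _ sm rho1 rhos tM) -addrA -mulrDr; congr (_ + _ * _).
  have : (2 ^ s.+1 = 2 * 2 ^ s)%N by rewrite expnS.
  move: tM; move: (2 ^ s.+1)%N (2 ^ s)%N => M K tM E; rewrite {M}E in tM *.
  have [le|lt] := leqP.
    rewrite expr1; have -> : minn t' (2 * K - t') = (minn t'.+1 (2 * K - t'.+1)).+1 by lia.
    by rewrite -natr1 addrK.
  by rewrite expr0 natr1; congr _%:R; lia.
have E0 : forall q', dirichlet m rho (2 ^ s.+1 * q') = 0.
  elim=> [|q' IH]; first by rewrite muln0 /dirichlet big_nil.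
  by rewrite mulnS addnC E// IH subnn minn0 mulr0 addr0.
by move=> tM; rewrite E// E0 add0r.
Qed.

Lemma sum_natV_ge0 a b : 0 <= \sum_(a <= k < b) (k%:R^-1 : R).
Proof. by rewrite sumr_ge0// => i _; rewrite invr_ge0. Qed.

Lemma sum_natV_dyadic_le a b : (a <= b)%N ->
  \sum_(2 ^ a <= k < 2 ^ b) (k%:R^-1 : R) <= (b - a)%:R.
Proof.
elim: b => [|b IH]; first by rewrite leqn0 => /eqP ->; rewrite big_geq.
rewrite leq_eqVlt => /orP[/eqP ->|]; first by rewrite subnn big_geq.
rewrite ltnS => ab; rewrite (big_cat_nat (n := 2 ^ b))/= ?leq_pexp2l//.
rewrite subSn// -natr1 lerD ?IH//.
apply: (@le_trans _ _ (\sum_(2 ^ b <= k < 2 ^ b.+1) (2 ^ b)%:R^-1)).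
  apply: ler_sum_nat => k /andP[bk _].
  by rewrite lef_pV2 ?posrE ?ltr0n ?expn_gt0// ?ler_nat// (leq_trans _ bk)// expn_gt0.
by rewrite big_const_nat iter_addr_0 expnS mul2n -addnn addnK -[_ *+ (2 ^ b)]mulr_natr mulVf//.
Qed.

Lemma sum_natV_dyadic_ge a b : (a <= b)%N ->
  (b - a)%:R / 2 <= \sum_(2 ^ a <= k < 2 ^ b) (k%:R^-1 : R).
Proof.
elim: b => [|b IH]; first by rewrite leqn0 => /eqP ->; rewrite big_geq// mul0r.
rewrite leq_eqVlt => /orP[/eqP ->|]; first by rewrite subnn big_geq// mul0r.
rewrite ltnS => ab; rewrite (big_cat_nat (n := 2 ^ b))/= ?leq_pexp2l//.
rewrite subSn// -natr1 mulrDl lerD ?IH//.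
apply: (@le_trans _ _ (\sum_(2 ^ b <= k < 2 ^ b.+1) (2 ^ b.+1)%:R^-1)); last first.
  apply: ler_sum_nat => k /andP[bk kb].
  have k0 : (0 < k)%N by rewrite (leq_trans _ bk)// expn_gt0.
  by rewrite lef_pV2 ?posrE ?ltr0n ?expn_gt0// ?ler_nat// ltnW.
rewrite big_const_nat iter_addr_0 expnS mul2n -addnn addnK -[_ *+ (2 ^ b)]mulr_natr.
have n0 : (2 ^ b)%:R != 0 :> R by rewrite pnatr_eq0 -lt0n expn_gt0.
have -> : 1 / 2 = (2 ^ b + 2 ^ b)%:R^-1 * (2 ^ b)%:R :> R; last by [].
rewrite natrD; move: (_ %:R) n0 => x x0; field.
by rewrite -mulr2n mulrn_eq0 ?x0.
Qed.

(* The binary digits of [2 ^ m %/ 3] alternate. *)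
Lemma modn_third_pow2 m s : (2 <= s < m)%N ->
  (2 ^ s.-1 <= (2 ^ m %/ 3) %% 2 ^ s.+1 <= 3 * 2 ^ s.-1)%N.
Proof.
move=> /andP[s2 sm].
have e3 : (2 ^ m %% 3 != 0)%N by rewrite -/(dvdn _ _) Euclid_dvdX//.
have := divn_eq (2 ^ m) 3; have := ltn_pmod (2 ^ m) (isT : (0 < 3)%N).
have Mm : (2 ^ m = 2 ^ s.+1 * 2 ^ (m - s.+1))%N by rewrite -expnD subnKC.
have := divn_eq (2 ^ m %/ 3) (2 ^ s.+1); have := ltn_pmod (2 ^ m %/ 3) (expn_gt0 2 s.+1).
have E1 : (2 ^ s.+1 = 4 * 2 ^ s.-1)%N by rewrite -[in LHS](prednK (ltnW s2)) 2!expnS mulnA.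
have E2 : (2 <= 2 ^ s.-1)%N by rewrite -[X in (X <= _)%N](expn1 2) leq_exp2l//; lia.
move: e3 Mm; move: (2 ^ m)%N (2 ^ m %/ 3)%N (2 ^ m %% 3)%N => N n e.
move: (n %/ 2 ^ s.+1)%N (n %% 2 ^ s.+1)%N (2 ^ (m - s.+1))%N => q r c.
rewrite E1; move: (2 ^ s.-1)%N E2 => K K2 e0 -> rK -> e3 Nq.
have q1 : (3 * q < c)%N.
  by rewrite -(@ltn_pmul2l (4 * K)) ?muln_gt0 ?(ltnW K2)// Nq; lia.
have q2 : (c < 3 * q + 3)%N.
  by rewrite -(@ltn_pmul2l (4 * K)) ?muln_gt0 ?(ltnW K2)// Nq; lia.
(* [c - 3 * q] is 1 or 2, and [r] is that many thirds of [4 * K], up to an error below 1. *)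
have [E|E] : c = (3 * q).+1 \/ c = (3 * q).+2 by lia.
all: by rewrite E in Nq; move: Nq; rewrite !mulnS; lia.
Qed.

Lemma dirichlet_norm_le m rho s N : (s < m)%N ->
  (forall i, `|rho i| = 1) ->
  (forall i, (i < s)%N -> rho i = 1) -> rho s = -1 ->
  `|dirichlet m rho N| <= 2 ^+ s.
Proof.
move=> sm nrho rho1 rhos.
rewrite (divn_eq N (2 ^ s.+1)) mulnC dirichlet_block//; last first.
  by rewrite ltnW// ltn_pmod// expn_gt0.
rewrite normrM /sign_char normr_prod big1// mul1r ger0_norm// -natrX ler_nat.
by rewrite expnS; move: (2 ^ s)%N => K; lia.
Qed.

(** Put [n = 2 ^ m %/ 3] and let [r] be its residue modulo [2 ^ s.+1]. The kernels of order [n - k]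
    with [k <= r] share one sign and give the main term [a]; those with [k > r] are at most [2 ^ s]
    in absolute value and meet a harmonic sum of size at most [m - s.-1]. The second hypothesis is
    what lets [a] dominate after division by the weight, which is at most [m]. *)
Lemma norlund_kernel_ge m rho s : (2 <= s < m)%N ->
  (m + 4 + 16 * (m - s + 1) <= 2 * s)%N ->
  (forall i, `|rho i| = 1) ->
  (forall i, (i < s)%N -> rho i = 1) -> rho s = -1 ->
  2 ^+ s / 16 <= `|(\sum_(1 <= k < 2 ^ m %/ 3) k%:R^-1)^-1 *
     \sum_(1 <= k < 2 ^ m %/ 3) dirichlet m rho (2 ^ m %/ 3 - k) / k%:R|.
Proof.
move=> /[dup] s2m /andP[s2 sm] hm nrho rho1 rhos.
have /andP[rl ru] := modn_third_pow2 s2m.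
set n := (2 ^ m %/ 3)%N in rl ru *; set r := (n %% 2 ^ s.+1)%N in rl ru *.
have n2m : (n < 2 ^ m)%N by rewrite ltn_Pdiv// expn_gt0.
have rn : (r <= n)%N := leq_mod _ _.
have E1 : (2 ^ s.+1 = 8 * 2 ^ s.-2)%N.
  by rewrite -[in LHS](subnKC s2) addSn 3!expnS !mulnA subn2.
have E2 : (2 ^ s.-1 = 2 * 2 ^ s.-2)%N by rewrite -expnS; congr (_ ^ _)%N; lia.
have K1 : (0 < 2 ^ s.-2)%N by rewrite expn_gt0.
have E3 : 2 ^+ s = 4 * 2 ^+ s.-2 :> R.
  by rewrite -[in LHS](subnKC s2) exprD subn2 -natrX.
have n2 : (1 < n)%N by lia.
have hn0 : 0 < \sum_(1 <= k < n) (k%:R^-1 : R).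
  rewrite big_ltn// invr1.
  by rewrite ltr_pwDl// sum_natV_ge0.
have hnm : \sum_(1 <= k < n) (k%:R^-1 : R) <= m%:R.
  rewrite -[m in m%:R]subn0; apply: le_trans (sum_natV_dyadic_le (leq0n m)).
  rewrite expn0 [leRHS](big_cat_nat (n := n)) //=; [|lia|lia].
  by rewrite lerDl sum_natV_ge0.
rewrite normrM gtr0_norm ?invr_gt0// [leRHS]mulrC ler_pdivlMr//.
(* The added term [k = n] contains an empty kernel and vanishes; it permits the splitting at [r.+1]
   even when [r = n]. *)
have -> : \sum_(1 <= k < n) dirichlet m rho (n - k) / k%:R =
    \sum_(1 <= k < n.+1) dirichlet m rho (n - k) / k%:R.
  by rewrite [RHS]big_nat_recr ?(ltnW n2)//= subnn [X in _ + X / _]big_geq// mul0r addr0.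
rewrite [X in _ <= `|X|](big_cat_nat (n := r.+1))//=.
have -> : \sum_(1 <= i < r.+1) dirichlet m rho (n - i) / i%:R =
   sign_char m rho (2 ^ s.+1 * (n %/ 2 ^ s.+1)) *
   \sum_(1 <= i < r.+1) (minn (r - i) (2 ^ s.+1 - (r - i)))%:R / i%:R.
  rewrite mulr_sumr; apply: eq_big_nat => i /andP[i0 ir].
  rewrite mulrA; congr (_ / _); rewrite -dirichlet_block//; last first.
    by rewrite (leq_trans (leq_subr _ _))// ltnW// ltn_pmod// expn_gt0.
  by congr dirichlet; rewrite {1}(divn_eq n (2 ^ s.+1)) -/r; nia.
set a := \sum_(1 <= i < r.+1) _; set b := \sum_(r.+1 <= i < _) _; set z := sign_char _ _ _.
have nz : `|z| = 1 by rewrite /z /sign_char normr_prod big1.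
(* Only [i < 2 ^ s.-2] is kept: there [r - i] has distance at least [2 ^ s.-2] from both ends of the
   block. *)
have a_ge : 2 ^+ s.-2 * (s.-2%:R / 2) <= a.
  rewrite /a (big_cat_nat (n := (2 ^ s.-2)%N))//=; [|lia].
  rewrite -[leLHS]addr0 lerD//; last by apply: sumr_ge0 => i _; rewrite divr_ge0.
  have := sum_natV_dyadic_ge (leq0n s.-2); rewrite subn0 expn0 => H.
  apply: (le_trans (ler_wpM2l _ H)); first by rewrite exprn_ge0.
  rewrite mulr_sumr; apply: ler_sum_nat => i /andP[i0 iK].
  rewrite ler_wpM2r ?invr_ge0// -natrX ler_nat.
  lia.
have b_le : `|b| <= 2 ^+ s * (m - s.-1)%:R.
  apply: le_trans (ler_norm_sum _ _ _) _.
  apply: (@le_trans _ _ (\sum_(r.+1 <= k < n.+1) 2 ^+ s * k%:R^-1)).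
    apply: ler_sum_nat => i _; rewrite normrM normfV normr_nat ler_wpM2r ?invr_ge0//.
    exact: dirichlet_norm_le.
  rewrite -mulr_sumr ler_wpM2l ?exprn_ge0//.
  apply: le_trans (sum_natV_dyadic_le _); last lia.
  rewrite [leRHS](big_cat_nat (n := r.+1)) //=; [|lia|lia].
  rewrite -[leLHS]add0r lerD ?sum_natV_ge0//.
  by rewrite [leRHS](big_cat_nat (n := n.+1)) //= lerDl sum_natV_ge0.
have ab : a - `|b| <= `|z * a + b|.
  rewrite lerBlDr; apply: (@le_trans _ _ `|z * a|).
    by rewrite normrM nz mul1r ler_norm.
  by rewrite -{1}[z * a](addrK b) ler_normB.
apply: le_trans ab.
have A : 2 ^+ s / 16 * (\sum_(1 <= k < n) k%:R^-1) <= 2 ^+ s / 16 * m%:R :> R.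
  by rewrite ler_wpM2l// divr_ge0// exprn_ge0.
have hm' : m%:R + 16 * (m - s.-1)%:R <= 2 * s.-2%:R :> R.
  by rewrite -!natrM -natrD ler_nat; lia.
have P0 : 0 < 2 ^+ s.-2 :> R by rewrite exprn_gt0.
rewrite E3 in A b_le *; nra.
Qed.
End sign_characters.

(** * Coverings and random signs *)

(** Bernoulli's inequality for [(1 + w / x) ^ P], cleared of denominators. *)
Lemma bernoulli_expn x w P : (x ^ P * (x + P * w) <= (x + w) ^ P * x)%N.
Proof.
elim: P => [|P IH]; first by rewrite !expn0 mul0n addn0.
rewrite !expnS; apply: (@leq_trans ((x + w) * (x ^ P * (x + P * w)))%N).
  by move: (x ^ P)%N => z; nia.
by rewrite -mulnA leq_mul2l IH orbT.
Qed.

(** Bernoulli's inequality with [x = g - w] gives [(g / (g - w)) ^ P >= 2]. The case [g <= w] is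
    separate because subtraction is truncated. *)
Lemma half_expn_le g w P : (0 < g)%N -> (g <= P * w)%N -> (2 * (g - w) ^ P <= g ^ P)%N.
Proof.
move=> g0 gPw; have [gw|wg] := leqP g w; first rewrite -subn_eq0 in gw.
  have P0 : (0 < P)%N by case: P gPw => //; lia.
  by rewrite (eqP gw) exp0n// muln0.
have x0 : (0 < g - w)%N by lia.
have := bernoulli_expn (g - w) w P; rewrite (subnK (ltnW wg)) => H.
rewrite -(leq_pmul2r x0); apply: leq_trans H.
by rewrite -mulnA mulnCA leq_mul2l; apply/orP; right; lia.
Qed.

Section covering.
Variables (A X : finType) (Y : {set A}) (rel : A -> X -> bool) (w : nat).
Hypothesis wP : forall x, (w <= #|[set a in Y | rel a x]|)%N.

Let uncovered (S : {set A}) := [set x | ~~ [exists a in S, rel a x]].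

(** Each uncovered point is related to at least [w] elements of [Y], so by averaging some [a] in [Y]
    covers a proportion at least [w / #|Y|] of the uncovered points. Adding it multiplies their
    number by at most [1 - w / #|Y|]. *)
Lemma greedy_cover P : (0 < w)%N -> exists S : {set A},
  [/\ S \subset Y, (#|S| <= P)%N &
      (#|uncovered S| * #|Y| ^ P <= #|X| * (#|Y| - w) ^ P)%N].
Proof.
move=> w0; elim: P => [|P [S [SY SP US]]].
  by exists finset.set0; rewrite finset.sub0set cards0 !muln1 max_card.
have [U0|[x0 x0U]] := set_0Vmem (uncovered S).
  by exists S; rewrite U0 cards0 mul0n (leq_trans SP).
have [a aY aU] : exists2 a, a \in Y &
    (#|uncovered S| * w <= #|uncovered S :&: [set x | rel a x]| * #|Y|)%N.
  apply/exists_inP; apply: contraT => /exists_inPn lt.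
  have [a0 a0Y] : exists a, a \in Y.
    have : (0 < #|[set a in Y | rel a x0]|)%N := leq_trans w0 (wP x0).
    by case/card_gt0P => a; rewrite inE => /andP[aY _]; exists a.
  (* Double counting of the related pairs formed by an uncovered point and an element of [Y]. *)
  have le : (#|uncovered S| * w <= \sum_(a in Y) #|uncovered S :&: [set x | rel a x]|)%N.
    rewrite -sum_nat_const; apply: (@leq_trans (\sum_(x in uncovered S) #|[set a in Y | rel a x]|)).
      exact: leq_sum.
    under eq_bigr do rewrite -sum1_card.
    under [leqRHS]eq_bigr do rewrite -sum1_card.
    rewrite (exchange_big_dep (mem Y))/=; last by move=> x a _; rewrite inE => /andP[].
    apply: leq_sum => a aY; rewrite leq_eqVlt; apply/orP; left; apply/eqP.
    by apply: eq_bigl => x; rewrite !inE aY.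
  have : (\sum_(a in Y) #|uncovered S :&: [set x | rel a x]| * #|Y| <
          \sum_(a in Y) #|uncovered S| * w)%N.
    rewrite (bigD1 a0)//= [ltnRHS](bigD1 a0)//= -addSn leq_add//.
      by rewrite ltnNge lt.
    by apply: leq_sum => a /andP[aY _]; rewrite ltnW// ltnNge lt.
  by rewrite -big_distrl/= sum_nat_const [ltnLHS]mulnC ltn_mul2l [X in _ && X]ltnNge le andbF.
exists (a |: S); split.
- by rewrite finset.subUset finset.sub1set aY.
- by rewrite (leq_trans (leq_card_setU _ _))// cards1 add1n.
have -> : uncovered (a |: S) = uncovered S :\: [set x | rel a x].
  apply/finset.setP => x; rewrite !inE -negb_or; congr (~~ _).
  apply/exists_inP/orP => [[b]|[ax|/exists_inP[b bS bx]]].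
  - by rewrite !inE => /orP[/eqP ->|bS bx]; [left|right; apply/exists_inP; exists b].
  - by exists a => //; rewrite !inE eqxx.
  - by exists b => //; rewrite !inE bS orbT.
have wY : (w <= #|Y|)%N.
  by rewrite (leq_trans (wP x0))// subset_leq_card//; apply/fintype.subsetP => b; rewrite inE => /andP[].
have := cardsID [set x | rel a x] (uncovered S).
move: US aU wY; rewrite !expnS.
move: #|uncovered S| #|_ :&: _| #|_ :\: _| #|Y| (#|Y| ^ P)%N ((#|Y| - w) ^ P)%N => u i e y yP zP.
move=> US aU wY uie; apply: (@leq_trans ((y - w) * (u * yP))%N); last by nia.
by rewrite !mulnA leq_mul2r mulnBl; apply/orP; right; rewrite -uie in aU *; lia.
Qed.

(** The greedy choice is run for [#|Y| %/ w + 1] steps: enough to halve the uncovered part, and few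
    enough for the size bound since [w <= #|Y|]. *)
Lemma half_cover : (0 < w)%N -> exists S : {set A},
  [/\ S \subset Y, (#|S| * w <= 2 * #|Y|)%N &
      (#|X| <= 2 * #|[set x | [exists a in S, rel a x]]|)%N].
Proof.
move=> w0; have [x0 _|X0] := pickP (@predT X); last first.
  by exists finset.set0; rewrite finset.sub0set cards0 (eq_card0 X0).
have wY : (w <= #|Y|)%N.
  by rewrite (leq_trans (wP x0))// subset_leq_card//; apply/fintype.subsetP => b; rewrite inE => /andP[].
have [S [SY SP US]] := greedy_cover (#|Y| %/ w).+1 w0; exists S; split=> //.
  rewrite (leq_trans (leq_mul SP (leqnn w)))// mulSn mul2n -addnn leq_add//.
  exact: leq_trunc_div.
have /half_expn_le H : (#|Y| <= (#|Y| %/ w).+1 * w)%N by rewrite ltnW// ltn_ceil.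
have Y0 : (0 < #|Y|)%N by exact: leq_trans wY.
have U2 : (2 * #|uncovered S| <= #|X|)%N.
  rewrite -(@leq_pmul2r (#|Y| ^ (#|Y| %/ w).+1)) ?expn_gt0 ?Y0// -mulnA.
  apply: (@leq_trans (2 * (#|X| * (#|Y| - w) ^ (#|Y| %/ w).+1))).
    by rewrite leq_mul2l US orbT.
  by rewrite mulnCA leq_mul2l H ?orbT.
have := cardsC [set x | [exists a in S, rel a x]].
rewrite (_ : ~: _ = uncovered S); last by apply/finset.setP => x; rewrite !inE.
lia.
Qed.
End covering.

Section random_signs.
Context {R : realDomainType} {A X : finType}.

(* Averaging over all sign patterns: flipping the sign of one term [a] cannot keep a sum
   below [`|c a x|] in absolute value. *)
Lemma exists_good_signs (S : {set A}) (c : A -> X -> R) (v : R) (cov : {set X}) :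
  (forall x, x \in cov -> exists2 a, a \in S & v <= `|c a x|) ->
  exists eps : {ffun A -> bool},
    (#|cov| <= 2 * #|[set x | (v <= `|\sum_(a in S) (-1) ^+ eps a * c a x|)%R]|)%N.
Proof.
move=> hc; pose good (e : {ffun A -> bool}) x := v <= `|\sum_(a in S) (-1) ^+ e a * c a x|.
have half x : x \in cov ->
    (#|{: {ffun A -> bool}}| <= 2 * #|[set e | good e x]|)%N.
  move=> /hc[a aS vc].
  pose flip (e : {ffun A -> bool}) := [ffun b => if b == a then ~~ e b else e b].
  have flipK : involutive flip.
    by move=> e; apply/ffunP => b; rewrite !ffunE; case: eqP => // _; rewrite negbK.
  have badflip e : ~~ good e x -> good (flip e) x.
    rewrite /good -ltNge (bigD1 a)//= => lt; rewrite (bigD1 a)//=.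
    have E : \sum_(i in S | i != a) (-1) ^+ flip e i * c i x =
             \sum_(i in S | i != a) (-1) ^+ e i * c i x.
      by apply: eq_bigr => i /andP[_ ia]; rewrite ffunE (negbTE ia).
    rewrite E ffunE eqxx; move: lt; set r := \sum_(i in S | _) _ => lt.
    have sgn : (-1) ^+ (~~ e a) = - (-1) ^+ e a :> R by case: (e a); rewrite ?expr0 ?expr1 ?opprK.
    rewrite sgn mulNr; set z := (-1) ^+ e a * c a x in lt *.
    have nz : `|z| = `|c a x| by rewrite /z normrM normrX normrN1 expr1n mul1r.
    rewrite -nz in vc; have : `|z *+ 2| <= `|z + r| + `|- z + r|.
      rewrite -[`|- z + r|]normrN opprD opprK; apply: le_trans (ler_normD _ _).
      by rewrite addrACA subrr addr0 mulr2n.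
    by rewrite normrMn mulr2n; lra.
  rewrite -cardsT -(cardsID [set e | good e x] finset.setT) finset.setTI mul2n -addnn leq_add2l.
  rewrite -(card_imset _ (can_inj flipK)); apply: subset_leq_card.
  by apply/fintype.subsetP => e /imsetP[e' /[!inE] /andP[/badflip ge _]] ->.
(* Double counting of the good pairs; some sign pattern does at least as well as the average. *)
have tot : (\sum_(x in cov) #|{: {ffun A -> bool}}| <=
   2 * \sum_(e : {ffun A -> bool}) #|[set x | good e x]|)%N.
  apply: (@leq_trans (\sum_(x in cov) 2 * #|[set e | good e x]|)); first exact: leq_sum.
  rewrite -big_distrr/= leq_mul2l/=.
  under eq_bigr do rewrite -sum1_card.
  under [leqRHS]eq_bigr do rewrite -sum1_card.
  under eq_bigr do under eq_bigl do rewrite inE.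
  rewrite (exchange_big_dep predT)//=; apply: leq_sum => e _.
  rewrite [leqRHS](eq_bigl (fun x => good e x)); last by move=> x; rewrite inE.
  by rewrite big_mkcondl/=; apply: leq_sum => x _; case: ifP.
apply/existsP; apply: contraLR tot; rewrite negb_exists => /forallP lt.
rewrite -ltnNge sum_nat_const big_distrr/= mulnC -sum_nat_const.
have [e0] : exists e0 : {ffun A -> bool}, true by exists [ffun=> true].
move=> _; rewrite (bigD1 e0)//= [ltnRHS](bigD1 e0)//= -addSn leq_add//.
  by rewrite ltnNge lt.
by apply: leq_sum => e _; rewrite ltnW// ltnNge lt.
Qed.
End random_signs.

(** * Counting bit vectors *)

Lemma card_family_prod (aT : finType) (rT : finType) (F : aT -> pred rT) :
  #|family F| = (\prod_(x : aT) #|F x|)%N.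
Proof. by rewrite card_family foldrE /image_mem big_map big_enum. Qed.

Notation bitvec m := {ffun 'I_m -> bool}.

Section bit_cells.
Variable m : nat.
Implicit Types (a b : bitvec m) (t : nat).

(* The bit vectors whose first bit different from [b] has index [m.-1 - t]. *)
Definition bit_shell t b : pred (bitvec m) :=
  family (fun i : 'I_m => if (i < m.-1 - t)%N then pred1 (b i)
                          else if (i == m.-1 - t :> nat)%N then pred1 (~~ b i) else predT).

Lemma card_bit_shell t b : (t < m)%N -> #|bit_shell t b| = (2 ^ t)%N.
Proof.
move=> tm; rewrite card_family_prod.
rewrite (eq_bigr (fun i : 'I_m => if (i <= m.-1 - t)%N then 1%N else 2)%N); last first.
  move=> i _; case: ltnP => [/ltnW -> |le]; first by rewrite card1.
  case: eqP => [->|/eqP ne]; first by rewrite leqnn card1.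
  by rewrite leqNgt ltn_neqAle eq_sym ne le/= card_bool.
rewrite -(big_mkord predT (fun i => if (i <= m.-1 - t)%N then 1%N else 2)).
rewrite (big_cat_nat (n := (m.-1 - t).+1))//=; last lia.
rewrite [X in (X * _)%N]big_nat_cond big1 ?mul1n; last first.
  by move=> i /andP[/andP[_ lt] _]; rewrite -ltnS lt.
rewrite big_nat_cond (eq_bigr (fun=> 2%N)); last first.
  by move=> i /andP[/andP[lt _] _]; rewrite leqNgt lt.
rewrite -big_nat_cond big_const_nat iter_muln_1.
by congr expn; lia.
Qed.

(** If [t < t'], the bit of index [m.-1 - t'] would both agree with [b] and differ from it. Hence
    the shells around [b] are disjoint. *)
Lemma bit_shell_inj t t' a b : (t < m)%N -> (t' < m)%N ->
  bit_shell t b a -> bit_shell t' b a -> t = t'.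
Proof.
wlog tt' : t t' / (t <= t')%N.
  by move=> W tm t'm h h'; have [/W|/ltnW/W] := leqP t t'; [apply|move=> ->].
move=> tm t'm /familyP h /familyP h'; apply/eqP; rewrite eqn_leq tt'/= leqNgt.
apply/negP => lt; have lt' : (m.-1 - t' < m)%N by lia.
have := h (Ordinal lt'); have := h' (Ordinal lt'); rewrite /= ltnn eqxx.
have -> : (m.-1 - t' < m.-1 - t)%N by lia.
by rewrite !inE => /eqP ->; case: (b _).
Qed.

Variables (d : nat) (B : {set 'I_d}).

(* The centres are normalised outside [B], where they play no role. *)
Definition anchored : {set {ffun 'I_d -> bitvec m}} :=
  [set a in family (fun i : 'I_d => if i \in B then predT else pred1 [ffun=> false])].

Lemma card_anchored : #|anchored| = (2 ^ (m * #|B|))%N.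
Proof.
rewrite /anchored cardsE card_family_prod (bigID (mem B))/=.
rewrite [X in (_ * X)%N]big1 ?muln1; last by move=> i /negbTE ->; rewrite card1.
rewrite (eq_bigr (fun=> 2 ^ m)%N); last first.
  by move=> i ->; rewrite card_ffun card_bool card_ord.
by rewrite prod_nat_const expnM.
Qed.

Definition shell (tau : 'I_d -> nat) (b : {ffun 'I_d -> bitvec m}) :
    pred {ffun 'I_d -> bitvec m} :=
  family (fun i : 'I_d => if i \in B then bit_shell (tau i) (b i)
                          else pred1 [ffun=> false]).

(** Fixing the exponents to 0 outside [B] makes the shells of distinct [tau] disjoint. *)
Definition compositions L : {set {ffun 'I_d -> 'I_L.+1}} :=
  [set tau : {ffun 'I_d -> 'I_L.+1} | (\sum_(i in B) tau i == L)%N && [forall (i | i \notin B), tau i == ord0]].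

(** A dyadic hyperbolic level set: the product over [B] of the dyadic distances between [a i] and
    [b i] is of order [2 ^ (L - m * #|B|)]. *)
Definition nearby L (a b : {ffun 'I_d -> bitvec m}) :=
  [exists tau in compositions L, shell (fun i => tau i) b a].

(** Shells with distinct [tau] are disjoint, and each has [\prod_(i in B) 2 ^ tau i = 2 ^ L]
    elements. *)
Lemma card_nearby L (b : {ffun 'I_d -> bitvec m}) : (L < m)%N ->
  (#|compositions L| * 2 ^ L <= #|[set a in anchored | nearby L a b]|)%N.
Proof.
move=> Lm; rewrite -sum_nat_const.
have tm (tau : {ffun 'I_d -> 'I_L.+1}) i : (tau i < m)%N by rewrite (leq_trans (ltn_ord _)).
rewrite (eq_bigr (fun tau : {ffun 'I_d -> 'I_L.+1} => #|shell (fun i => tau i) b|)); last first.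
  move=> tau; rewrite inE => /andP[/eqP sL _].
  rewrite card_family_prod (bigID (mem B))/=.
  rewrite [X in (_ * X)%N]big1 ?muln1; last by move=> i /negbTE ->; rewrite card1.
  rewrite (eq_bigr (fun i => 2 ^ tau i)%N); first by rewrite -expn_sum sL.
  by move=> i ->; rewrite card_bit_shell.
under eq_bigr do rewrite -sum1_card.
rewrite (exchange_big_dep predT)//=.
rewrite -sum1_card [leqRHS]big_mkcond/=; apply: leq_sum => a _.
rewrite sum1_card; case: ifPn => [_|]; last first.
  apply: contraR; rewrite -ltnNge => /card_gt0P[tau]; rewrite !inE => /andP[ct sh].
  apply/andP; split; last by apply/exists_inP; exists tau => //; rewrite inE.
  by apply/familyP => i; have := familyP sh i; case: ifP.
apply/card_le1_eqP => tau tau'.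
rewrite unfold_in => /andP[] /[!inE] /andP[_ /forall_inP t0] sh.
rewrite unfold_in => /andP[] /[!inE] /andP[_ /forall_inP t0'] sh'.
apply/ffunP => i; have [iB|iB] := boolP (i \in B).
  have := familyP sh i; have := familyP sh' i; rewrite iB => h h'.
  by apply/val_inj; exact: (bit_shell_inj (tm _ _) (tm _ _) h h').
by rewrite (eqP (t0 _ iB)) (eqP (t0' _ iB)).
Qed.

(** All coordinates in [B] except [i0] range freely over [0, ..., L %/ #|B|], and the coordinate
    [i0] completes the sum to [L]. *)
Lemma card_compositions L : (0 < #|B|)%N ->
  (L ^ #|B|.-1 <= #|B| ^ #|B|.-1 * #|compositions L|)%N.
Proof.
move=> /card_gt0P[i0 i0B]; set q := (L %/ #|B|)%N.
have k0 : (0 < #|B|)%N by apply/card_gt0P; exists i0.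
pose G := family (fun i : 'I_d => if i \in B :\ i0 then [pred x : 'I_L.+1 | (x < q.+1)%N]
                                  else pred1 ord0).
have cq : #|[pred x : 'I_L.+1 | (x < q.+1)%N]| = q.+1.
  have qL : (q.+1 <= L.+1)%N by rewrite ltnS leq_div.
  by rewrite -sum1_card (big_ord_narrow qL) sum1_card card_ord.
have cG : #|G| = (q.+1 ^ #|B|.-1)%N.
  rewrite card_family_prod (bigID (mem (B :\ i0)))/=.
  rewrite [X in (_ * X)%N]big1 ?muln1; last by move=> i /negbTE ->; rewrite card1.
  rewrite (eq_bigr (fun=> q.+1)); last by move=> i ->; rewrite cq.
  by rewrite prod_nat_const (cardsD1 i0 B) i0B.
pose phi (g : {ffun 'I_d -> 'I_L.+1}) : {ffun 'I_d -> 'I_L.+1} :=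
  [ffun i => if i == i0 then inord (L - \sum_(j in B :\ i0) g j) else g i].
have sumG g : g \in G -> (\sum_(j in B :\ i0) g j <= L)%N.
  move=> /familyP gG; apply: (@leq_trans (\sum_(j in B :\ i0) q)%N).
    by apply: leq_sum => j jB; have := gG j; rewrite jB inE ltnS.
  rewrite sum_nat_const (leq_trans _ (leq_trunc_div L #|B|))// mulnC leq_mul//.
  by rewrite subset_leq_card// finset.subsetDl.
have phiG g : g \in G -> phi g \in compositions L.
  move=> gG; rewrite inE; apply/andP; split.
    rewrite (bigD1 i0)//= ffunE eqxx inordK; last by rewrite ltnS leq_subr.
    rewrite [X in (_ + X)%N](_ : _ = \sum_(j in B :\ i0) g j)%N; first by rewrite subnK// sumG.
    apply: eq_big => [j|j /andP[_ /negbTE ji0]]; first by rewrite !inE andbC.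
    by rewrite ffunE ji0.
  apply/forall_inP => i iB; rewrite ffunE; case: (i =P i0) => [ii0|_]; first by rewrite ii0 i0B in iB.
  by have := familyP gG i; rewrite !inE (negbTE iB) andbF.
have phi_inj : {in G &, injective phi}.
  move=> g g' gG g'G /ffunP E; apply/ffunP => i; have := E i; rewrite !ffunE.
  case: eqP => // -> _; have := familyP gG i0; have := familyP g'G i0.
  by rewrite !inE eqxx/= => /eqP -> /eqP ->.
apply: (@leq_trans (#|B| ^ #|B|.-1 * q.+1 ^ #|B|.-1)%N).
  case: #|B|.-1 => // e.
  by rewrite -expnMn leq_exp2r// mulnC ltnW// ltn_ceil.
rewrite leq_mul2l -cG -(card_in_imset phi_inj); apply/orP; right.
by apply: subset_leq_card; apply/fintype.subsetP => _ /imsetP[g gG ->]; exact: phiG.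
Qed.
End bit_cells.

Local Open Scope classical_set_scope.
Local Open Scope ring_scope.

(** * Dyadic cells of the unit cube *)

Section dyadic_cells.
Context {R : realType}.

Definition bit (i : nat) (x : R) : bool :=
  ~~ (2 ^+ i * x - (Num.floor (2 ^+ i * x))%:~R < 2^-1).

Lemma rademacher_bit i (x : R) : rademacher i x = (-1) ^+ bit i x.
Proof. by rewrite /rademacher /bit; case: ifP; rewrite ?expr0 ?expr1. Qed.

(** One more digit selects the left or the right half of the dyadic interval, so [q] becomes
    [2 * q + y m]. *)
Lemma bits_itv (y : nat -> bool) m : exists q : nat, forall x : R,
  (0 <= x < 1 /\ forall i, (i < m)%N -> bit i x = y i) <->
  q%:R <= 2 ^+ m * x < q%:R + 1.
Proof.
elim: m => [|m [q IH]].
  by exists 0%N => x; rewrite expr0 mul1r add0r; split => [[]//|->].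
exists (2 * q + y m)%N => x.
have -> : (0 <= x < 1 /\ (forall i, (i < m.+1)%N -> bit i x = y i)) <->
    q%:R <= 2 ^+ m * x < q%:R + 1 /\ bit m x = y m.
  rewrite -IH; split => [[x01 b]|[[x01 b] bm]].
    by split; [split=> // i im; apply: b; exact: ltnW|exact: b].
  split=> // i; rewrite ltnS leq_eqVlt => /orP[/eqP ->//|]; exact: b.
rewrite natrD natrM exprS -mulrA; set z := 2 ^+ m * x.
have fl : q%:R <= z < q%:R + 1 -> bit m x = ~~ (z - q%:R < 2^-1).
  move=> zq; rewrite /bit -/z; congr (~~ (_ - _ < _)).
  have -> : Num.floor z = q%:Z by apply: floor_def; rewrite intrD.
  by [].
case: (y m) fl; rewrite /= => fl; split.
- by move=> [zq]; rewrite fl// -leNgt => h; move/andP: zq => [z1 z2]; apply/andP; split; lra.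
- move=> /andP[h1 h2]; have zq : q%:R <= z < q%:R + 1 by apply/andP; split; lra.
  by split=> //; rewrite fl// -leNgt; lra.
- move=> [zq]; rewrite fl// => /negbFE h; move/andP: zq => [z1 z2].
  by apply/andP; split; lra.
- move=> /andP[h1 h2]; have zq : q%:R <= z < q%:R + 1 by apply/andP; split; lra.
  by split=> //; rewrite fl//; apply/negbF; lra.
Qed.

Definition bits m (x : R) : bitvec m := [ffun i : 'I_m => bit i x].

Lemma bits_cell m (b : bitvec m) : exists q : nat,
  [set` `[0 : R, 1[] `&` [set x | bits m x = b] =
  [set` `[(q%:R / 2 ^+ m : R), ((q%:R + 1) / 2 ^+ m)[].
Proof.
pose y i := if insub i is Some o then b o else false.
have [q qP] := bits_itv y m; exists q; apply/seteqP.
have E x : q%:R <= 2 ^+ m * x < q%:R + 1 <->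
    [set` `[(q%:R / 2 ^+ m : R), ((q%:R + 1) / 2 ^+ m)[] x.
  by rewrite /= in_itv/= ler_pdivrMr ?exprn_gt0// ltr_pdivlMr ?exprn_gt0// [x * _]mulrC.
split=> x; rewrite /= ?in_itv/=.
  move=> [x01 xb]; apply/E/qP; split=> // i im.
  by have /= := congr1 (fun f : bitvec m => f (Ordinal im)) xb; rewrite ffunE /y insubT.
move=> /E/qP[x01 xb]; split=> //; apply/ffunP => i.
rewrite ffunE xb// /y; case: insubP; last by rewrite ltn_ord.
by move=> o _ /val_inj ->.
Qed.

Definition bits_set m (b : bitvec m) : set (measurableTypeR R) :=
  [set` `[0 : R, 1[] `&` [set x | bits m x = b].

Lemma measurable_bits_set m (b : bitvec m) : measurable (bits_set b).
Proof. by rewrite /bits_set; have [q ->] := bits_cell b; exact: measurable_itv. Qed.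

Lemma lebesgue_bits_set m (b : bitvec m) :
  lebesgue_measure (bits_set b) = (2 ^- m)%:E.
Proof.
rewrite /bits_set; have [q ->] := bits_cell b.
rewrite lebesgue_measure_itv/= lte_fin ltr_pM2r ?invr_gt0 ?exprn_gt0// ltrDl ltr01.
by rewrite -EFinB -mulrBl addrC addKr mul1r.
Qed.

Variable d : nat.

Definition cell m (x : euclid R d) : {ffun 'I_d -> bitvec m} :=
  [ffun i => bits m (tnth x i)].

Definition cell_set m (b : {ffun 'I_d -> bitvec m}) : set (euclid R d) :=
  box (fun i => bits_set (b i)).

Lemma cell_setE m (b : {ffun 'I_d -> bitvec m}) :
  cell_set b = unit_cube R d `&` [set x | cell m x = b].
Proof.
apply/seteqP; split=> [x xb|x [x01 /= xb] i].
  by split=> [i|]; [have [] := xb i|apply/ffunP => i; rewrite ffunE; have [] := xb i].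
by split; [exact: x01|rewrite /= -xb ffunE].
Qed.

Lemma measurable_cell_set m (b : {ffun 'I_d -> bitvec m}) : measurable (cell_set b).
Proof. by apply: measurable_box => i; exact: measurable_bits_set. Qed.

Lemma lebesgue_cell_set m (b : {ffun 'I_d -> bitvec m}) :
  lebesgue_tuple R d (cell_set b) = (2 ^- (m * d))%:E.
Proof.
rewrite lebesgue_tuple_box; last by move=> i; exact: measurable_bits_set.
under eq_bigr do rewrite lebesgue_bits_set.
by rewrite prodEFin prodr_const card_ord -exprVn -exprM exprVn.
Qed.

Lemma measurable_unit_cube : measurable (unit_cube R d).
Proof. by apply: measurable_box => i; exact: measurable_itv. Qed.

Lemma lebesgue_unit_cube : lebesgue_tuple R d (unit_cube R d) = 1%E.
Proof.
rewrite lebesgue_tuple_box; last by move=> i; exact: measurable_itv.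
by rewrite big1// => i _; rewrite lebesgue_measure_itv/= lte01 sube0.
Qed.

Lemma measurable_cells m (P : set {ffun 'I_d -> bitvec m}) :
  measurable (unit_cube R d `&` [set x | P (cell m x)]).
Proof.
rewrite (_ : _ `&` _ = \big[setU/set0]_(b | `[< P b >]) cell_set b).
  by apply: bigsetU_measurable => b _; exact: measurable_cell_set.
rewrite -bigcup_seq_cond; apply/seteqP; split=> [x [x01 Px]|x [b/= /andP[_ /asboolP Pb]]].
  by exists (cell m x) => /=; [rewrite mem_index_enum; exact/asboolP|rewrite cell_setE].
by rewrite cell_setE => -[x01 xb]; split=> //=; rewrite xb.
Qed.

Lemma measurable_step m dT (T : measurableType dT) (F : {ffun 'I_d -> bitvec m} -> T) :
  measurable_fun (unit_cube R d) (fun x => F (cell m x)).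
Proof. by move=> _ Y _; exact: (measurable_cells (fun b => Y (F b))). Qed.

Lemma integrable_step m (F : {ffun 'I_d -> bitvec m} -> R) :
  (lebesgue_tuple R d).-integrable (unit_cube R d) (EFin \o (fun x => F (cell m x))).
Proof.
apply: measurable_bounded_integrable => //.
- exact: measurable_unit_cube.
- by rewrite lebesgue_unit_cube ltry.
- exact: measurable_step.
exists (\sum_b `|F b|); split; first exact: num_real.
move=> M ltM x _; apply: le_trans (ltW ltM).
by rewrite (bigD1 (cell m x))//= lerDl sumr_ge0.
Qed.

Lemma integral_step m (F : {ffun 'I_d -> bitvec m} -> R) :
  (\int[lebesgue_tuple R d]_(x in unit_cube R d) (F (cell m x))%:E =
   (2 ^- (m * d) * \sum_b F b)%:E)%E.
Proof.
pose ind (b : {ffun 'I_d -> bitvec m}) (x : euclid R d) : \bar R :=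
  ((F b)%:E * (\1_(cell_set b) x)%:E)%E.
have iind b : (lebesgue_tuple R d).-integrable (unit_cube R d)
    (fun x => (\1_(cell_set b) x)%:E).
  apply: (eq_integrable measurable_unit_cube _ _ _ (integrable_step (fun b' => (b' == b)%:R))).
  move=> x; rewrite inE => x01 /=; congr (_%:E); rewrite indicE cell_setE; congr (nat_of_bool _)%:R.
  by apply/eqP/idP => [xb|]; [rewrite inE; split|rewrite inE => -[]].
rewrite (eq_integral (fun x => \sum_b ind b x)%E); last first.
  move=> x; rewrite inE => x01; rewrite (bigD1 (cell m x))//= big1 => [|b bx].
    by rewrite /ind indicE mem_set ?mule1 ?adde0// cell_setE.
  by rewrite /ind indicE memNset ?mule0// cell_setE => -[_ /= xb]; rewrite xb eqxx in bx.
rewrite integral_sum; [|exact: measurable_unit_cube|]; last first.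
  by move=> b; apply: integrableZl => //; exact: measurable_unit_cube.
rewrite mulr_sumr -sumEFin; apply: eq_bigr => b _.
rewrite integralZl//; last exact: measurable_unit_cube.
rewrite integral_indic//; [|exact: measurable_unit_cube|exact: measurable_cell_set].
rewrite setIidl; last by rewrite cell_setE => x [].
by rewrite lebesgue_cell_set -EFinM mulrC.
Qed.

Lemma lebesgue_cells m (P : pred {ffun 'I_d -> bitvec m}) :
  lebesgue_tuple R d (unit_cube R d `&` [set x | P (cell m x)]) =
  (#|P|%:R / 2 ^+ (m * d))%:E.
Proof.
have mP := measurable_cells P; have mc := measurable_unit_cube.
rewrite -[X in lebesgue_tuple _ _ X](setIidl (B := unit_cube R d)); last by move=> x [].
rewrite -(integral_indic (lebesgue_tuple R d) mc mP).
rewrite (eq_integral (fun x => (P (cell m x))%:R%:E)); last first.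
  move=> x; rewrite inE => x01; rewrite indicE; congr (nat_of_bool _)%:R%:E.
  by apply/idP/idP => [|Px]; [rewrite inE => -[]|rewrite inE].
rewrite (integral_step (fun b => (P b)%:R)) mulrC; congr (_ / _)%:E.
by rewrite -sum1_card natr_sum [RHS]big_mkcond/=; apply: eq_bigr => b _; rewrite unfold_in; case: (P b).
Qed.

End dyadic_cells.

(** * Walsh means of step functions *)

(** Distributivity for index ranges that depend on the coordinate, as in rectangular sums. The
    condition [P] is absorbed by putting the excluded terms equal to 0. *)
Lemma bigA_distr_dffun (R : comPzRingType) (I : finType) (N : I -> nat)
    (P : I -> pred nat) (g : I -> nat -> R) :
  \sum_(j : {dffun forall i : I, 'I_(N i)} | [forall i, P i (j i)]) \prod_i g i (j i) =
  \prod_i \sum_(t < N i | P i t) g i t.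
Proof.
pose h i : {ffun 'I_(N i) -> R} := [ffun t : 'I_(N i) => if P i t then g i t else 0].
have -> : \sum_(j : {dffun forall i : I, 'I_(N i)} | [forall i, P i (j i)])
    \prod_i g i (j i) = \sum_(j : {dffun forall i : I, 'I_(N i)}) \prod_i h i (j i).
  rewrite big_mkcond; apply: eq_bigr => j _; case: ifPn => [/forallP Pj|].
    by apply: eq_bigr => i _; rewrite ffunE Pj.
  by rewrite negb_forall => /existsP[i /negbTE Pi]; rewrite (bigD1 i)//= ffunE Pi mul0r.
rewrite (reindex (@dffun_of_fprod I (fun i => 'I_(N i)))); last first.
  exact/onW_bij/dffun_of_fprod_bij.
rewrite (eq_bigr (fun t : fprod (fun i => 'I_(N i)) => \prod_(i in I) h i (t i))); last first.
  by move=> t _; apply: eq_bigr => i _; have -> : dffun_of_fprod t i = t i by rewrite ffunE.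
rewrite (big_fprod 1 +%R h) -(bigA_distr_big_dep _ (fun i => untag 0 (h i))).
apply: eq_bigr => i _; rewrite -[LHS](big_tag (fun i x => h i x) i).
by rewrite [RHS]big_mkcond; apply: eq_bigr => t _; rewrite ffunE.
Qed.

Section walsh_cells.
Context {R : realType}.

(** The value on a dyadic cell of the Walsh function of index [j < 2 ^ m], that is, a character of
    the group of bit vectors. *)
Definition bit_char m (b : bitvec m) (j : nat) : R :=
  \prod_(i < m | odd (j %/ 2 ^ i)) (-1) ^+ b i.

Lemma walsh_bits m j (x : R) : (j < 2 ^ m)%N -> walsh j x = bit_char (bits m x) j.
Proof.
move=> jm; rewrite /walsh /bit_char.
have E : \prod_(i < j | odd (j %/ 2 ^ i)) rademacher i x =
    \prod_(i < m | odd (j %/ 2 ^ i)) rademacher i x.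
  (* [walsh] runs over the digits below [j], [bit_char] over those below [m]. Both products are
     extended to [m + j]; the additional digits of [j] vanish. *)
  have le1 : (j <= m + j)%N by lia.
  have le2 : (m <= m + j)%N by lia.
  rewrite (big_ord_widen_cond _ (fun i => odd (j %/ 2 ^ i)) (fun i => rademacher i x) le1).
  rewrite [RHS](big_ord_widen_cond _ (fun i => odd (j %/ 2 ^ i)) (fun i => rademacher i x) le2).
  apply: eq_bigl => i; have [od|//] := boolP (odd _); rewrite /=.
  have lt n : (j < 2 ^ n)%N -> (i < n)%N.
    move=> jn; rewrite ltnNge; apply/negP => ni; move: od.
    by rewrite divn_small// (leq_trans jn)// leq_exp2l.
  by rewrite !lt// ltn_expl.
by rewrite E; apply: eq_bigr => i _; rewrite rademacher_bit ffunE.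
Qed.

Lemma walsh_tensor_cell d m (j : 'I_d -> nat) (x : euclid R d) :
  (forall i, (j i < 2 ^ m)%N) ->
  walsh_tensor j x = \prod_(i < d) bit_char (cell m x i) (j i).
Proof. by move=> jm; apply: eq_bigr => i _; rewrite ffunE (walsh_bits _ (jm i)). Qed.

Lemma walsh_norm j (x : R) : `|walsh j x| = 1.
Proof.
rewrite normr_prod big1// => i _; rewrite rademacher_bit.
by rewrite normrX normrN1 expr1n.
Qed.

Lemma walsh_tensor_norm d (j : 'I_d -> nat) (x : euclid R d) : `|walsh_tensor j x| = 1.
Proof. by rewrite normr_prod big1// => i _; rewrite walsh_norm. Qed.

Lemma exists_dyadic_bound d (j : 'I_d -> nat) : exists m, forall i, (j i <= 2 ^ m)%N.
Proof.
exists (\max_(i < d) j i)%N => i; apply: ltnW.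
by rewrite (leq_ltn_trans (leq_bigmax i))// ltn_expl.
Qed.

Lemma measurable_walsh_tensor d (j : 'I_d -> nat) :
  measurable_fun (unit_cube R d) (@walsh_tensor R d j).
Proof.
have [m jm] := exists_dyadic_bound (fun i => (j i).+1).
apply: (eq_measurable_fun _ _ (@measurable_step R d m _ _
  (fun b => \prod_(i < d) bit_char (b i) (j i) : R))) => x _.
by rewrite (walsh_tensor_cell _ jm).
Qed.

Lemma walsh_coef_step d m (F : {ffun 'I_d -> bitvec m} -> R) f (j : 'I_d -> nat) :
  (forall x, unit_cube R d x -> f x = F (cell m x)) -> (forall i, (j i < 2 ^ m)%N) ->
  walsh_coef f j = 2 ^- (m * d) * \sum_b F b * \prod_(i < d) bit_char (b i) (j i).
Proof.
move=> fF jm; rewrite /walsh_coef /Rintegral.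
rewrite (eq_integral (fun x => (F (cell m x) * \prod_(i < d) bit_char (cell m x i) (j i))%:E)).
  by rewrite (integral_step (fun b => F b * \prod_(i < d) bit_char (b i) (j i))).
by move=> x; rewrite inE => x01; rewrite fF// (walsh_tensor_cell _ jm).
Qed.

Definition bit_dirichlet m (N : nat) (a b : bitvec m) : R :=
  \sum_(0 <= t < N) bit_char a t * bit_char b t.

Lemma rect_sum_step d m (F : {ffun 'I_d -> bitvec m} -> R) f (N : 'I_d -> nat) x :
  (forall x, unit_cube R d x -> f x = F (cell m x)) -> (forall i, (N i <= 2 ^ m)%N) ->
  rect_sum f N x = \sum_b F b * \prod_(i < d) (2 ^- m * bit_dirichlet (N i) (b i) (cell m x i)).
Proof.
move=> fF Nm; rewrite /rect_sum.
pose g (b : {ffun 'I_d -> bitvec m}) i t : R :=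
  2 ^- m * (bit_char (b i) t * bit_char (cell m x i) t).
transitivity (\sum_(j : {dffun forall i : 'I_d, 'I_(N i)})
    \sum_b F b * \prod_(i < d) g b i (j i)).
  apply: eq_bigr => j _; have jm i : (j i < 2 ^ m)%N by exact: leq_trans (ltn_ord _) (Nm i).
  rewrite (walsh_coef_step fF jm) (walsh_tensor_cell _ jm) mulr_sumr mulr_suml.
  apply: eq_bigr => b _; rewrite /g !big_split/= prodr_const card_ord.
  by rewrite exprM exprVn; ring.
rewrite exchange_big/=; apply: eq_bigr => b _; rewrite -mulr_sumr; congr (_ * _).
rewrite (eq_bigl (fun j : {dffun forall i : 'I_d, 'I_(N i)} => [forall i, predT (j i : nat)])).
  rewrite (bigA_distr_dffun N (fun=> predT) (g b)); apply: eq_bigr => i _.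
  by rewrite /bit_dirichlet mulr_sumr big_mkord.
by move=> j; apply/esym/forallP.
Qed.

(** The factor [2 ^- m] is the length of a one-dimensional cell, so that plain sums over cells
    replace integrals. *)
Definition log_kernel d m (B : {set 'I_d}) (n : nat) (i : 'I_d) (a b : bitvec m) : R :=
  2 ^- m * ((log_weight n)^-1 *
    \sum_(1 <= t < n) bit_dirichlet (if i \in B then n - t else t)%N a b / t%:R).

(** Weights, characters and cell lengths all factor over the coordinates, so the sum over
    multi-indices turns into a product of one-dimensional kernels. *)
Lemma log_mean_step d m (B : {set 'I_d}) (F : {ffun 'I_d -> bitvec m} -> R) f (n : 'I_d -> nat) x :
  (forall x, unit_cube R d x -> f x = F (cell m x)) -> (forall i, (n i <= 2 ^ m)%N) ->
  log_mean B f n x = \sum_b F b * \prod_(i < d) log_kernel B (n i) i (b i) (cell m x i).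
Proof.
move=> fF nm; rewrite /log_mean.
pose N i t := if i \in B then (n i - t)%N else t.
pose g (b : {ffun 'I_d -> bitvec m}) i t : R :=
  (log_weight (n i))^-1 * (2 ^- m * bit_dirichlet (N i t) (b i) (cell m x i) / t%:R).
transitivity (\sum_(j : {dffun forall i : 'I_d, 'I_(n i)} | [forall i, (0 < j i)%N])
    \sum_b F b * \prod_(i < d) g b i (j i)).
  rewrite mulr_sumr; apply: eq_bigr => j _; rewrite (rect_sum_step _ fF); last first.
    move=> i; apply: leq_trans (nm i); case: ifP => _; first exact: leq_subr.
    exact: ltnW.
  rewrite mulr_suml mulr_sumr; apply: eq_bigr => b _; rewrite /g !big_split/=.
  by rewrite !prodfV; ring.
rewrite exchange_big/=; apply: eq_bigr => b _; rewrite -mulr_sumr; congr (_ * _).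
rewrite (bigA_distr_dffun n (fun=> [pred t | (0 < t)%N]) (g b)); apply: eq_bigr => i _.
rewrite /g -mulr_sumr /log_kernel [RHS]mulrCA; congr (_ * _).
rewrite big_mkcond -(big_mkord predT (fun t => if [pred t | (0 < t)%N] t then
  2 ^- m * bit_dirichlet (N i t) (b i) (cell m x i) / t%:R else 0)) /=.
have [n0|n0] := posnP (n i); first by rewrite n0 !big_geq// mulr0.
rewrite big_ltn//= add0r mulr_sumr; apply: eq_big_nat => t /andP[t0 _].
by rewrite t0 mulrA.
Qed.

(** Orthogonality of characters: if [j] is not 0, one of its digits below [m] is set and contributes
    the factor [1 + (-1)]. *)
Lemma sum_bit_char m (b : bitvec m) j : (j < 2 ^ m)%N ->
  \sum_(a : bitvec m) bit_char a j = if j == 0%N then 2 ^+ m else 0.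
Proof.
move=> jm; pose h (i : 'I_m) (c : bool) : R := if odd (j %/ 2 ^ i) then (-1) ^+ c else 1.
transitivity (\prod_(i < m) \sum_(c : bool) h i c).
  by rewrite bigA_distr_bigA; apply: eq_bigr => a _; rewrite /bit_char big_mkcond.
case: eqP => [j0|/eqP j0].
  rewrite (eq_bigr (fun=> 2)); first by rewrite prodr_const card_ord.
  by move=> i _; rewrite /h j0 div0n big_bool/=.
have : exists i : 'I_m, odd (j %/ 2 ^ i).
  apply/existsP; apply: contraT; rewrite negb_exists => /forallP even.
  suff : j = 0%N by move/eqP; rewrite (negbTE j0).
  have : forall n, (n <= m)%N -> (2 ^ n %| j)%N.
    elim=> [|n IH] nm; first by rewrite dvd1n.
    have := even (Ordinal nm); rewrite /= => ev; have /dvdnP[q E] := IH (ltnW nm).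
    move: ev; rewrite E mulnK ?expn_gt0// => ev.
    rewrite expnS dvdn_pmul2r ?expn_gt0// dvdn2//.
  by move=> /(_ m (leqnn m)); rewrite /dvdn modn_small// => /eqP.
move=> [i oi]; rewrite (bigD1 i)//= big_bool/= /h oi expr0 expr1 addNr mul0r//.
Qed.

(** Every Dirichlet kernel of positive order has mean 1, and the weights of the Riesz mean are
    normalised. This removes the variables outside [B] from the estimate. *)
Lemma sum_log_kernel d m (B : {set 'I_d}) n i (b : bitvec m) :
  i \notin B -> (2 <= n <= 2 ^ m)%N -> \sum_a log_kernel B n i a b = 1.
Proof.
move=> /negbTE iB /andP[n2 nm]; rewrite /log_kernel iB -!mulr_sumr exchange_big/=.
have bc0 (c : bitvec m) : bit_char c 0 = 1 by rewrite /bit_char big1// => k; rewrite div0n.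
have sD t : (0 < t)%N -> (t < n)%N -> \sum_(a : bitvec m) bit_dirichlet t a b = 2 ^+ m.
  move=> t0 tn; rewrite /bit_dirichlet exchange_big/=.
  rewrite big_ltn//= -mulr_suml sum_bit_char ?expn_gt0//= bc0 mulr1.
  rewrite big_nat_cond big1 ?addr0// => k /andP[/andP[k0 kt] _].
  by rewrite -mulr_suml sum_bit_char ?gtn_eqF ?mul0r//; lia.
rewrite (eq_big_nat _ _ (F2 := fun t => 2 ^+ m * t%:R^-1)); last first.
  by move=> t /andP[t0 tn]; rewrite -mulr_suml sD.
have lw0 : @log_weight R n != 0.
  by rewrite /log_weight gt_eqF// big_ltn// invr1 ltr_pwDl// sum_natV_ge0.
have m0 : 2 ^+ m != 0 :> R by rewrite expf_neq0.
by rewrite -mulr_sumr -/(log_weight n) mulrCA mulKf// mulVf.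
Qed.

(** The signs of [a (+) b] first become negative at [s = m.-1 - t]. For this [s] the hypothesis of
    [norlund_kernel_ge] reads [18 * t + 38 <= m], and its bound [2 ^+ s / 16] times [2 ^- m] is
    [2 ^- (t + 5)]. *)
Lemma log_kernel_ge d m (B : {set 'I_d}) i t (a b : bitvec m) :
  i \in B -> (18 * t + 38 <= m)%N -> bit_shell t b a ->
  2 ^- (t + 5) <= `|log_kernel B (2 ^ m %/ 3) i a b|.
Proof.
move=> iB tm /familyP ab; rewrite /log_kernel iB.
pose rho k : R := if insub k is Some o then (-1) ^+ (a o (+) b o) else 1.
have rhoE (o : 'I_m) : rho o = (-1) ^+ (a o (+) b o).
  by rewrite /rho; case: insubP => [k' _ /val_inj ->//|]; rewrite ltn_ord.
have DE N : bit_dirichlet N a b = dirichlet m rho N.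
  apply: eq_bigr => j _; rewrite /bit_char /sign_char -big_split/=.
  by apply: eq_bigr => o _; rewrite rhoE signr_addb.
have nrho k : `|rho k| = 1.
  by rewrite /rho; case: insubP => [k' _ _|_]; rewrite ?normr1// normrX normrN1 expr1n.
pose s := (m.-1 - t)%N; have sm : (s < m)%N by rewrite /s; lia.
have rho1 k : (k < s)%N -> rho k = 1.
  move=> ks; have km : (k < m)%N by exact: ltn_trans sm.
  have := ab (Ordinal km); rewrite -[k]/(nat_of_ord (Ordinal km)) rhoE /= -/s ks inE => /eqP ->.
  by rewrite addbb.
have rhos : rho s = -1.
  have := ab (Ordinal sm); rewrite -[s in rho s]/(nat_of_ord (Ordinal sm)) rhoE /= -/s.
  by rewrite ltnn eqxx inE => /eqP ->; case: (b _).
under eq_bigr do rewrite DE.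
have s2 : (2 <= s < m)%N by rewrite sm /s; lia.
have := norlund_kernel_ge s2 _ nrho rho1 rhos; rewrite -/(log_weight _) => /(_ _) K.
rewrite normrM ger0_norm ?invr_ge0 ?exprn_ge0//.
apply: (@le_trans _ _ (2 ^- m * (2 ^+ s / 16))); last first.
  by rewrite ler_wpM2l ?invr_ge0 ?exprn_ge0// K// /s; lia.
have E : 2 ^+ m = 2 ^+ s * (2 ^+ t * 2) :> R.
  by rewrite -exprSr -exprD; congr (_ ^+ _); rewrite /s; lia.
rewrite exprD E le_eqVlt; apply/orP; left; apply/eqP.
have x0 : 2 ^+ s != 0 :> R by rewrite expf_neq0.
have y0 : 2 ^+ t != 0 :> R by rewrite expf_neq0.
by field; rewrite ?x0 ?y0.
Qed.
End walsh_cells.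

(** * Extremal functions *)

Section extremal_functions.
Context {R : realType} {d : nat}.
Variables (B : {set 'I_d}) (m : nat).
Implicit Types (a b y : {ffun 'I_d -> bitvec m}).

Definition match_on a y : R := \prod_(i in B) (y i == a i)%:R.

Definition anchor y : {ffun 'I_d -> bitvec m} :=
  [ffun i => if i \in B then y i else [ffun=> false]].

(** Each [y] matches exactly one anchored centre, so the indicators [match_on a] of distinct
    anchored [a] have disjoint supports. *)
Lemma match_on_anchor a y : a \in anchored m B -> match_on a y = (anchor y == a)%:R.
Proof.
rewrite inE => /familyP aB; have [ya|/eqP ya] := boolP (anchor y == a).
  rewrite /match_on big1// => i iB; rewrite -(eqP ya) ffunE iB eqxx//.
have [i iB yi] : exists2 i, i \in B & y i != a i.
  apply/exists_inP; apply: contraT; rewrite negb_exists_in => /forall_inP h.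
  exfalso; apply: ya; apply/ffunP => i; rewrite ffunE; case: ifPn => iB.
    by have := h i iB; rewrite negbK => /eqP.
  by have := aB i; rewrite (negbTE iB) inE => /eqP ->.
by rewrite /match_on (bigD1 i)//= (negbTE yi) mul0r.
Qed.

(** Pairing a product kernel with [match_on a] evaluates the factors in [B] at [a] and sums the
    other factors freely. *)
Lemma sum_match_on a (K : 'I_d -> bitvec m -> R) :
  \sum_(y : {ffun 'I_d -> bitvec m}) match_on a y * \prod_(i < d) K i (y i) =
  \prod_(i in B) K i (a i) * \prod_(i | i \notin B) \sum_v K i v.
Proof.
transitivity (\sum_(y : {ffun 'I_d -> bitvec m}) \prod_(i < d) ((if i \in B then (y i == a i)%:R else 1) * K i (y i))).
  by apply: eq_bigr => y _; rewrite big_split/= -big_mkcond.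
rewrite -(bigA_distr_bigA (fun i v => (if i \in B then (v == a i)%:R else 1) * K i v)).
rewrite (bigID (mem B))/=; congr (_ * _).
  apply: eq_bigr => i ->; rewrite (bigD1 (a i))//= eqxx mul1r big1 ?addr0//.
  by move=> v /negbTE ->; rewrite mul0r.
by apply: eq_bigr => i /negbTE ->; apply: eq_bigr => v _; rewrite mul1r.
Qed.

Lemma card_cells : #|{: {ffun 'I_d -> bitvec m}}| = (2 ^ (m * d))%N.
Proof. by rewrite !card_ffun card_bool !card_ord expnM. Qed.

(** [F] is [u] times a signed sum of indicators of the columns over the centres chosen by
    [half_cover]. Their number is at most [2 * 2 ^ (m * #|B|) / w], which bounds the modular.
    Covering keeps half of the cells and the choice of signs half of those, hence the measure
    1/4. *)
Lemma exists_extremal_step (Q : R -> R) (u : R) (L : nat) :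
  Q 0 = 0 -> 0 < u -> (1 < #|B|)%N -> (0 < L)%N -> (18 * L + 38 <= m)%N ->
  2 * Q u <= (#|compositions B L| * 2 ^ L)%:R ->
  exists F : {ffun 'I_d -> bitvec m} -> R,
    (\int[lebesgue_tuple R d]_(x in unit_cube R d) (Q `|F (cell m x)|)%:E <= 1)%E /\
    (4^-1%:E <= lebesgue_tuple R d (unit_cube R d `&`
       [set x | (u / 2 ^+ (L + 5 * #|B|) <=
        `|log_mean B (fun x => F (cell m x)) (fun=> (2 ^ m %/ 3)%N) x|)%R]))%E.
Proof.
move=> Q0 u0 B1 L0 Lm Qw; set n := (2 ^ m %/ 3)%N; set w := (_ * _)%N in Qw.
have w0 : (0 < w)%N.
  rewrite muln_gt0 expn_gt0 andbT lt0n; apply/eqP => c0.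
  have := card_compositions L (ltnW B1); rewrite c0 muln0 leqn0 => /eqP E.
  by have := expn_gt0 L #|B|.-1; rewrite E L0.
have LM : (L < m)%N by lia.
have m7 : (7 <= m)%N by lia.
have n2 : (2 <= n <= 2 ^ m)%N.
  apply/andP; split; last by rewrite /n leq_div.
  by rewrite /n leq_divRL// (@leq_trans (2 ^ 7)%N)// leq_exp2l.
have [S [SY Sw Scov]] := half_cover (fun b => card_nearby B b LM) w0.
pose c a b : R := u * \prod_(i in B) log_kernel B n i (a i) (b i).
pose v : R := u / 2 ^+ (L + 5 * #|B|).
(* At a cell [b] with a nearby centre [a], the product kernel is at least the product of the
   [2 ^- (tau i + 5)], that is [2 ^- (L + 5 * #|B|)]. *)
have [|eps epsP] := @exists_good_signs R _ _ S c v [set b | [exists a in S, nearby B L a b]].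
  move=> b; rewrite inE => /exists_inP[a aS /exists_inP[tau]].
  rewrite inE => /andP[/eqP tL _] /familyP ab; exists a => //.
  rewrite /c normrM gtr0_norm// ler_pM2l// normr_prod.
  apply: (@le_trans _ _ (\prod_(i in B) 2 ^- (tau i + 5))).
    by rewrite prodfV prodrXr big_split/= tL sum_nat_const mulnC.
  apply: ler_prod => i iB; rewrite invr_ge0 exprn_ge0//=.
  apply: log_kernel_ge => //; last by have := ab i; rewrite iB.
  by apply: leq_trans Lm; rewrite leq_add2r leq_mul2l -ltnS ltn_ord.
pose F y : R := \sum_(a in S) (u * (-1) ^+ eps a) * match_on a y.
have aY a : a \in S -> a \in anchored m B by exact: (fintype.subsetP SY).
exists F; split.
  (* At most one centre contributes at [y], and its sign disappears in the absolute value, so [Q]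
     passes through the sum. *)
  have QF y : Q `|F y| = \sum_(a in S) Q u * match_on a y.
    have [yS|yS] := boolP (anchor y \in S).
      rewrite /F (bigD1 (anchor y))//= [in RHS](bigD1 (anchor y))//=.
      rewrite !match_on_anchor ?aY// eqxx !mulr1 !big1 ?addr0.
      - by rewrite normrM gtr0_norm// normrX normrN1 expr1n mulr1.
      - by move=> a /andP[aS ay]; rewrite match_on_anchor ?aY// eq_sym (negbTE ay) mulr0.
      - by move=> a /andP[aS ay]; rewrite match_on_anchor ?aY// eq_sym (negbTE ay) mulr0.
    rewrite /F !big1 ?normr0 ?Q0// => a aS; rewrite match_on_anchor ?aY//;
      by case: eqP => [ya|]; rewrite ?mulr0//; rewrite ya aS in yS.
  rewrite (integral_step (fun y => Q `|F y|)) lee_fin.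
  under eq_bigr do rewrite QF.
  rewrite exchange_big/=.
  have sm a : \sum_(y : {ffun 'I_d -> bitvec m}) Q u * match_on a y =
      Q u * (2 ^+ m) ^+ (d - #|B|).
    rewrite -mulr_sumr; congr (_ * _).
    transitivity (\sum_(y : {ffun 'I_d -> bitvec m}) match_on a y * \prod_(i < d) 1).
      by apply: eq_bigr => y _; rewrite big1 ?mulr1.
    rewrite (sum_match_on a (fun _ _ => 1)) big1 // mul1r (eq_bigr (fun=> 2 ^+ m)).
      rewrite prodr_const; congr (_ ^+ _).
      have := cardsC B; rewrite card_ord => dB; transitivity #|~: B|; last by lia.
      by apply: eq_card => i; rewrite !inE.
    by move=> i _; rewrite sumr_const card_ffun card_bool card_ord natrX.
  under eq_bigr do rewrite sm.
  rewrite sumr_const -[X in _ * X]mulr_natr.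
  have kd : (#|B| <= d)%N by have := max_card B; rewrite card_ord.
  have -> : 2 ^- (m * d) = (2 ^+ (m * #|B|))^-1 / (2 ^+ m) ^+ (d - #|B|) :> R.
    by rewrite -invfM -exprM -exprD -mulnDr subnKC.
  have X0 : (2 ^+ m) ^+ (d - #|B|) != 0 :> R by rewrite !expf_neq0.
  rewrite card_anchored in Sw.
  have Y0 : 0 < 2 ^+ (m * #|B|) :> R by rewrite exprn_gt0.
  rewrite [leLHS](_ : _ = Q u * #|S|%:R / 2 ^+ (m * #|B|)); last first.
    by field; rewrite X0 gt_eqF.
  rewrite ler_pdivrMr// mul1r.
  have SwR : #|S|%:R * w%:R <= 2 * 2 ^+ (m * #|B|) :> R.
    by rewrite -natrM -natrX -natrM ler_nat.
  have w0R : 0 < w%:R :> R by rewrite ltr0n.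
  have S0 : 0 <= #|S|%:R :> R by [].
  have : 2 * Q u * #|S|%:R <= w%:R * #|S|%:R by rewrite ler_wpM2r.
  by move: SwR; rewrite mulrC; lra.
have nm (i : 'I_d) : (n <= 2 ^ m)%N by case/andP: n2.
have LE x : log_mean B (fun x => F (cell m x)) (fun=> n) x =
    \sum_(a in S) (-1) ^+ eps a * c a (cell m x).
  rewrite (log_mean_step B x (fun _ _ => erefl) nm) /F.
  under eq_bigr do rewrite mulr_suml.
  rewrite exchange_big/=; apply: eq_bigr => a aS.
  under eq_bigr do rewrite -mulrA.
  rewrite -mulr_sumr (sum_match_on a (fun i v => log_kernel B n i v (cell m x i))).
  rewrite [X in _ * (_ * X)]big1 ?mulr1; last by move=> i iB; rewrite sum_log_kernel.
  by rewrite /c [in RHS]mulrA [u * (-1) ^+ _]mulrC.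
pose P b := v <= `|\sum_(a in S) (-1) ^+ eps a * c a b|.
rewrite (_ : _ `&` _ = unit_cube R d `&` [set x | P (cell m x)]); last first.
  by apply/seteqP; split=> x [x01]; rewrite /P /= LE.
rewrite lebesgue_cells lee_fin ler_pdivlMr ?exprn_gt0//.
have : (2 ^ (m * d) <= 4 * #|P|)%N.
  rewrite -card_cells (leq_trans Scov)// (_ : 4 = 2 * 2)%N// -mulnA leq_mul2l/=.
  by rewrite (leq_trans epsP)// leq_mul2l/= cardsE.
by rewrite -(ler_nat R) natrM natrX ler_pdivrMl.
Qed.
End extremal_functions.

(** * Orlicz spaces *)

Section young_functions.
Context {R : realType} (Q : R -> R).
Hypothesis hQ : young_function Q.

Lemma young_conv (t a b : R) : 0 <= t <= 1 ->
  Q (t * a + (1 - t) * b) <= t * Q a + (1 - t) * Q b.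
Proof.
move=> /andP[t0 t1]; have /(_ a b) := young_convex hQ (Itv01 t0 t1).
by rewrite !inE => /(_ Logic.I Logic.I); rewrite !convRE/=.
Qed.

Lemma young_norm u : Q `|u| = Q u.
Proof. by case: (ler0P u) => // _; rewrite young_even. Qed.

Lemma young_mid (a b : R) : Q ((a + b) / 2) <= (Q a + Q b) / 2.
Proof.
have h : 0 <= (2^-1 : R) <= 1 by apply/andP; split; lra.
have -> : (a + b) / 2 = 2^-1 * a + (1 - 2^-1) * b by field.
by apply: (le_trans (young_conv a b h)); lra.
Qed.

Lemma young_ge0 (u : R) : 0 <= Q u.
Proof.
by have := young_mid u (- u); rewrite (young_even hQ) subrr mul0r (young0 hQ); lra.
Qed.

Lemma young_scale (t u : R) : 0 <= t <= 1 -> Q (t * u) <= t * Q u.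
Proof. by move=> t01; have := young_conv u 0 t01; rewrite (young0 hQ) !mulr0 !addr0. Qed.

Lemma young_ge_id : exists2 u0 : R, 0 < u0 & forall u, u0 <= u -> u <= Q u.
Proof.
have /cvgryPge/(_ 1)[M [_ MP]] := young_superlinear hQ.
exists (Num.max M 0 + 1); first by rewrite ltr_pwDr// le_max lexx orbT.
move=> u hu; have [Mu u0] : M < u /\ 0 < u.
  by move: hu; rewrite -lerBrDr; case: (ltP M 0); lra.
by have := MP u Mu; rewrite ler_pdivlMr// mul1r.
Qed.

Lemma measurable_young d (D : set (euclid R d)) (f : euclid R d -> R) (k : R) :
  measurable_fun D f -> measurable_fun D (fun x => (Q (`|f x| / k))%:E).
Proof.
move=> mf; apply/measurable_EFinP; apply: measurableT_comp.
  exact: continuous_measurable_fun (young_continuous hQ).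
by apply: measurable_funM => //; exact: measurableT_comp.
Qed.
End young_functions.

Section orlicz_facts.
Context {R : realType} {d : nat}.
Local Notation mu := (lebesgue_tuple R d).
Local Notation cube := (unit_cube R d).
Implicit Types (f g : euclid R d -> R) (Q : R -> R).

(** The admissible constants of the Luxemburg norm; handling them as witnesses avoids computing with
    the infimum. *)
Definition modular_le1 Q (k : R) f :=
  0 < k /\ (\int[mu]_(x in cube) (Q (`|f x| / k))%:E <= 1)%E.

Lemma luxemburg_ltP Q f (e : \bar R) :
  (luxemburg_norm Q f < e)%E <-> exists2 k : R, modular_le1 Q k f & (k%:E < e)%E.
Proof.
split=> [/ereal_inf_lt[_ [k kP <-]] ke|[k kP ke]]; first by exists k.
by apply: le_lt_trans ke; apply: ereal_inf_lbound; exists k.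
Qed.

Lemma orlicz_spaceP Q f : orlicz_space d Q f <->
  measurable_fun cube f /\ exists k, modular_le1 Q k f.
Proof.
split=> [[mf /luxemburg_ltP[k kP _]]|[mf [k kP]]]; split=> //; first by exists k.
by apply/luxemburg_ltP; exists k => //; rewrite ltry.
Qed.

Variable Q : R -> R.
Hypothesis hQ : young_function Q.

Lemma modular_le1_ge k k' f : measurable_fun cube f -> modular_le1 Q k f -> k <= k' ->
  modular_le1 Q k' f.
Proof.
move=> mf [k0 kP] kk'; have k'0 := lt_le_trans k0 kk'; split=> //.
apply: le_trans kP; apply: ge0_le_integral => //.
- exact: measurable_unit_cube.
- by move=> x _; rewrite lee_fin (young_ge0 hQ).
- exact: (measurable_young hQ).
- exact: (measurable_young hQ).
move=> x _; rewrite lee_fin.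
have -> : `|f x| / k' = (k / k') * (`|f x| / k) by field; rewrite !gt_eqF.
have t01 : 0 <= k / k' <= 1.
  by rewrite (divr_ge0 (ltW k0) (ltW k'0)) ler_pdivrMr// mul1r.
apply: le_trans (young_scale hQ _ t01) _.
by rewrite ler_piMl ?(young_ge0 hQ)//; case/andP: t01.
Qed.

Lemma modular_le1_scale k c f : 0 < `|c| -> modular_le1 Q k f ->
  modular_le1 Q (`|c| * k) (fun x => c * f x).
Proof.
move=> c0 [k0 kP]; split; first exact: mulr_gt0.
rewrite (eq_integral (fun x => (Q (`|f x| / k))%:E))// => x _.
by congr ((Q _)%:E); rewrite normrM; field; rewrite !gt_eqF.
Qed.

(** Midpoint convexity of [Q] suffices because both functions come with the same constant [k]. *)
Lemma modular_le1_add k f g : measurable_fun cube f -> measurable_fun cube g ->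
  modular_le1 Q k f -> modular_le1 Q k g -> modular_le1 Q (2 * k) (fun x => f x + g x).
Proof.
move=> mf mg [k0 fk] [_ gk]; split; first by rewrite mulr_gt0.
have mc := @measurable_unit_cube R d.
apply: (@le_trans _ _ (\int[mu]_(x in cube) (2^-1%:E * ((Q (`|f x| / k))%:E + (Q (`|g x| / k))%:E)))%E).
  apply: ge0_le_integral => //.
  - by move=> x _; rewrite lee_fin (young_ge0 hQ).
  - by apply: (measurable_young hQ) => //; exact: measurable_funD.
  - apply: measurable_funeM; apply: emeasurable_funD; exact: (measurable_young hQ).
  move=> x _; rewrite -EFinD -EFinM lee_fin.
  have E h : Q (`|h| / k) = Q (h / k).
    by rewrite -(young_norm hQ (h / k)) normrM normfV (gtr0_norm k0).
  rewrite !E -(young_norm hQ) normrM normr_id -normrM (young_norm hQ).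
  rewrite [_ / _ in leLHS](_ : _ = (f x / k + g x / k) / 2); last by field; rewrite gt_eqF.
  by rewrite [leRHS]mulrC; exact: (young_mid hQ).
rewrite ge0_integralZl_EFin//; last 2 first.
- by move=> x _; rewrite -EFinD lee_fin addr_ge0// (young_ge0 hQ).
- by apply: emeasurable_funD; exact: (measurable_young hQ).
rewrite ge0_integralD//; [|by move=> x _; rewrite lee_fin (young_ge0 hQ)|exact: (measurable_young hQ)|by move=> x _; rewrite lee_fin (young_ge0 hQ)|exact: (measurable_young hQ)].
apply: (@le_trans _ _ (2^-1%:E * (1 + 1)))%E.
  by rewrite lee_wpmul2l ?lee_fin ?invr_ge0//; exact: leeD.
by rewrite -EFinD -EFinM lee_fin mulVf.
Qed.

Lemma orlicz_space_add f g : orlicz_space d Q f -> orlicz_space d Q g ->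
  orlicz_space d Q (fun x => f x + g x).
Proof.
move=> /orlicz_spaceP[mf [k kP]] /orlicz_spaceP[mg [k' k'P]].
apply/orlicz_spaceP; split; first exact: measurable_funD.
exists (2 * (Num.max k k')); apply: modular_le1_add => //.
- by apply: modular_le1_ge kP _ => //; rewrite le_max lexx.
- by apply: modular_le1_ge k'P _ => //; rewrite le_max lexx orbT.
Qed.

Lemma orlicz_space_scale f c : orlicz_space d Q f -> orlicz_space d Q (fun x => c * f x).
Proof.
move=> /orlicz_spaceP[mf [k kP]]; apply/orlicz_spaceP; split.
  by apply: measurable_funM.
have [->|c0] := eqVneq c 0; last by exists (`|c| * k); apply: modular_le1_scale; rewrite ?normr_gt0.
exists 1; split=> //; rewrite integral0_eq// => x _.
by rewrite mul0r normr0 mul0r (young0 hQ).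
Qed.

(** Superlinearity gives [u <= Q u] beyond some [u0], so [|f| / k] is at most [u0 + Q (|f| / k)],
    whose integral is at most [u0 + 1]. *)
Lemma orlicz_L1 : exists2 c : R, 0 < c & forall f k, measurable_fun cube f ->
  modular_le1 Q k f -> (\int[mu]_(x in cube) `|(f x)%:E| <= (c * k)%:E)%E.
Proof.
have [u0 u00 u0P] := young_ge_id hQ; exists (u0 + 1); first by rewrite addr_gt0.
move=> f k mf [k0 kP]; have mc := @measurable_unit_cube R d.
apply: (@le_trans _ _ (\int[mu]_(x in cube) (k%:E * (u0%:E + (Q (`|f x| / k))%:E)))%E).
  apply: ge0_le_integral => //.
  - by apply: measurableT_comp => //; exact/measurable_EFinP.
  - by apply: measurable_funeM; apply: emeasurable_funD => //; exact: (measurable_young hQ).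
  move=> x _; rewrite -EFinD -EFinM lee_fin -ler_pdivrMl// mulrC.
  have [le|lt] := leP (`|f x| / k) u0; first by rewrite (le_trans le)// lerDl (young_ge0 hQ).
  by rewrite (le_trans (u0P _ (ltW lt)))// lerDr ltW.
rewrite ge0_integralZl_EFin//; last 3 first.
- by move=> x _; rewrite -EFinD lee_fin addr_ge0 ?(young_ge0 hQ)// ltW.
- by apply: emeasurable_funD => //; exact: (measurable_young hQ).
- exact: ltW.
rewrite ge0_integralD//; [|by move=> x _; rewrite lee_fin ltW|by move=> x _; rewrite lee_fin (young_ge0 hQ)|exact: (measurable_young hQ)].
rewrite integral_cst// lebesgue_unit_cube mule1 mulrC EFinM lee_pmul2l ?lte_fin//.
by rewrite EFinD leeD2l.
Qed.

Lemma orlicz_integrable f : orlicz_space d Q f -> mu.-integrable cube (EFin \o f).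
Proof.
move=> /orlicz_spaceP[mf [k kP]]; apply/integrableP; split; first exact/measurable_EFinP.
have [c _ cP] := orlicz_L1; apply: le_lt_trans (cP _ _ mf kP) _.
by rewrite ltry.
Qed.

(** Otherwise [LlogL beta] would be dominated by [C * Q] beyond [u0], and integrating this
    domination would give the inclusion of the spaces. *)
Lemma not_sub_LlogL beta : 0 <= beta ->
  ~ (orlicz_space d Q `<=` orlicz_space d (LlogL beta)) ->
  forall C u0 : R, exists2 u, u0 <= u & C * Q u < LlogL beta u.
Proof.
move=> b0 hL C u0; apply: contrapT => nex; apply: hL => f /orlicz_spaceP[mf [k [k0 kP]]].
have mc := @measurable_unit_cube R d.
have lnge0 (u : R) : 0 <= ln (1 + `|u|) by rewrite ln_ge0// lerDl.
have le u : u0 <= u -> LlogL beta u <= C * Q u.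
  by move=> uu; rewrite leNgt; apply/negP => lt; apply: nex; exists u.
have mono (u v : R) : `|u| <= `|v| -> LlogL beta u <= LlogL beta v.
  move=> uv; rewrite /LlogL ler_pM// ?powR_ge0//.
  by rewrite ge0_ler_powR// ?nnegrE// ler_ln ?posrE ?ltr_pwDl// lerD2l.
have LL0 u : 0 <= LlogL beta u by rewrite /LlogL mulr_ge0// powR_ge0.
have scale (t u : R) : 0 <= t <= 1 -> LlogL beta (t * u) <= t * LlogL beta u.
  move=> /andP[t0 t1]; rewrite /LlogL normrM (ger0_norm t0) -mulrA ler_wpM2l//.
  rewrite ler_wpM2l// ge0_ler_powR ?nnegrE//.
    by rewrite -[t * `|u|](ger0_norm (mulr_ge0 t0 (normr_ge0 u))).
  by rewrite ler_ln ?posrE ?ltr_pwDl ?mulr_ge0// lerD2l ler_piMl.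
have mLL k' : measurable_fun cube (fun x => (LlogL beta (`|f x| / k'))%:E).
  have m1 : measurable_fun cube (fun x => `|f x| / k').
    by apply: measurable_funM => //; exact: measurableT_comp.
  have m2 : measurable_fun cube (fun x => `| (`|f x| / k') |) by exact: measurableT_comp.
  apply/measurable_EFinP; apply: measurable_funM => //.
  apply: (measurableT_comp (f := fun y : R => y `^ beta)); first exact: measurable_powR.
  by apply: measurableT_comp; [exact: measurable_ln|exact: measurable_funD].
(* Enlarging the norm constant by the factor [K] divides the modular by at least [K], which brings
   the bound [LlogL beta u0 + |C|] below 1. *)
pose K := LlogL beta u0 + `|C| + 1.
have K1 : 1 <= K by rewrite /K lerDr addr_ge0.
have K0 : 0 < K by exact: lt_le_trans K1.
apply/orlicz_spaceP; split=> //; exists (K * k); split; first exact: mulr_gt0.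
apply: (@le_trans _ _ (\int[mu]_(x in cube)
    (K^-1%:E * ((LlogL beta u0)%:E + `|C|%:E * (Q (`|f x| / k))%:E)))%E).
  apply: ge0_le_integral => //.
  - by move=> x _; rewrite lee_fin.
  - apply: measurable_funeM; apply: emeasurable_funD => //; apply: measurable_funeM.
    exact: (measurable_young hQ).
  move=> x _; rewrite -[leRHS]/((K^-1 * (LlogL beta u0 + `|C| * Q (`|f x| / k)))%:E) lee_fin.
  have -> : `|f x| / (K * k) = K^-1 * (`|f x| / k) by field; rewrite !gt_eqF.
  apply: le_trans (scale _ _ _) _; first by rewrite invr_ge0 (ltW K0) invf_le1.
  rewrite ler_wpM2l ?invr_ge0 ?(ltW K0)//.
  have [lu|lu] := leP u0 (`|f x| / k).
    apply: le_trans (le _ lu) _; rewrite -[leLHS]add0r lerD//.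
    by rewrite ler_wpM2r ?(young_ge0 hQ)// ler_norm.
  rewrite -[leLHS]addr0 lerD ?mulr_ge0 ?(young_ge0 hQ)// mono//.
  have a0 : 0 <= `|f x| / k by rewrite divr_ge0// ltW.
  by rewrite (ger0_norm a0) (ger0_norm (ltW (le_lt_trans a0 lu))) ltW.
rewrite ge0_integralZl_EFin//; last 3 first.
- by move=> x _; rewrite adde_ge0// ?lee_fin// mulr_ge0// (young_ge0 hQ).
- apply: emeasurable_funD => //; apply: measurable_funeM; exact: (measurable_young hQ).
- by rewrite invr_ge0 ltW.
rewrite ge0_integralD//; last 3 first.
- by move=> x _; rewrite lee_fin.
- by move=> x _; rewrite -EFinM lee_fin mulr_ge0// (young_ge0 hQ).
- by apply: measurable_funeM; exact: (measurable_young hQ).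
rewrite integral_cst// lebesgue_unit_cube mule1 ge0_integralZl_EFin//; last 2 first.
- by move=> x _; rewrite lee_fin (young_ge0 hQ).
- exact: (measurable_young hQ).
apply: (@le_trans _ _ (K^-1%:E * ((LlogL beta u0)%:E + `|C|%:E * 1)))%E.
  rewrite lee_wpmul2l ?lee_fin ?invr_ge0 ?(ltW K0)// leeD2l// lee_wpmul2l//.
by rewrite mule1 -EFinD -EFinM lee_fin ler_pdivrMl// mulr1 /K lerDl.
Qed.
End orlicz_facts.

(** * The logarithmic means as operators *)

Section log_mean_operator.
Context {R : realType} {d : nat}.
Local Notation mu := (lebesgue_tuple R d).
Local Notation cube := (unit_cube R d).
Implicit Types (f g : euclid R d -> R) (n : 'I_d -> nat) (B : {set 'I_d}).

Let mcube := @measurable_unit_cube R d.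

Lemma integrable_walsh f j : mu.-integrable cube (EFin \o f) ->
  mu.-integrable cube (EFin \o (fun x => f x * walsh_tensor j x)).
Proof.
move=> fi; have mf : measurable_fun cube f by apply/measurable_EFinP; exact: measurable_int fi.
apply: le_integrable fi => //.
  apply/measurable_EFinP; apply: measurable_funM => //; exact: measurable_walsh_tensor.
by move=> x _ /=; rewrite normrM walsh_tensor_norm mulr1.
Qed.

Lemma walsh_coef_linear a b f g j :
  mu.-integrable cube (EFin \o f) -> mu.-integrable cube (EFin \o g) ->
  walsh_coef (fun x => a * f x + b * g x) j = a * walsh_coef f j + b * walsh_coef g j.
Proof.
move=> fi gi; have fw := integrable_walsh j fi; have gw := integrable_walsh j gi.
rewrite /walsh_coef -!RintegralZl// -RintegralD//; last 2 first.
- exact: (@integrableZl _ _ _ mu _ mcube a _ fw).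
- exact: (@integrableZl _ _ _ mu _ mcube b _ gw).
by apply: eq_Rintegral => x _; ring.
Qed.

Lemma rect_sum_linear a b f g N x :
  mu.-integrable cube (EFin \o f) -> mu.-integrable cube (EFin \o g) ->
  rect_sum (fun x => a * f x + b * g x) N x = a * rect_sum f N x + b * rect_sum g N x.
Proof.
move=> fi gi; rewrite /rect_sum !mulr_sumr -big_split/=; apply: eq_bigr => j _.
by rewrite walsh_coef_linear//; ring.
Qed.

Lemma log_mean_linear B a b f g n x :
  mu.-integrable cube (EFin \o f) -> mu.-integrable cube (EFin \o g) ->
  log_mean B (fun x => a * f x + b * g x) n x = a * log_mean B f n x + b * log_mean B g n x.
Proof.
move=> fi gi; rewrite /log_mean !mulrA ![_ * (_)^-1]mulrC -!mulrA -mulrDr; congr (_ * _).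
rewrite !mulr_sumr -big_split/=; apply: eq_bigr => j _.
by rewrite rect_sum_linear// mulrDl !mulrA.
Qed.

(** For fixed [n] the mean is a finite sum, each coefficient is at most the L1 norm, and Walsh
    functions have modulus 1. The constant depends on [n], which is enough for the continuity of a
    single mean. *)
Lemma log_mean_bound B n : exists2 C : R, 0 < C & forall f x,
  mu.-integrable cube (EFin \o f) ->
  `|log_mean B f n x| <= C * \int[mu]_(y in cube) `|f y|.
Proof.
pose N (i : {dffun forall j : 'I_d, 'I_(n j)}) j := if j \in B then (n j - i j)%N else i j.
pose C : R := `|(\prod_(j < d) log_weight (n j))^-1| *
  \sum_(i : {dffun forall j : 'I_d, 'I_(n j)})
     #|{dffun forall k : 'I_d, 'I_(N i k)}|%:R / `|\prod_(j < d) (i j)%:R|.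
have C0 : 0 <= C by rewrite mulr_ge0// sumr_ge0// => i _; rewrite divr_ge0.
exists (C + 1); first by rewrite ltr_wpDl.
move=> f x fi; set I := \int[mu]_(y in cube) _.
have I0 : 0 <= I by rewrite Rintegral_ge0.
apply: (@le_trans _ _ (C * I)); last by rewrite ler_wpM2r// lerDl.
rewrite normrM /C -mulrA ler_wpM2l// mulr_suml.
apply: le_trans (ler_norm_sum _ _ _) _; rewrite big_mkcond; apply: ler_sum => i _.
case: ifP => _; last by rewrite mulr_ge0// divr_ge0.
rewrite normrM normfV mulrAC ler_wpM2r ?invr_ge0//.
apply: le_trans (ler_norm_sum _ _ _) _.
rewrite [leRHS]mulr_natl -sumr_const; apply: ler_sum => k _.
rewrite normrM walsh_tensor_norm mulr1.
have fw := integrable_walsh (fun i => k i) fi.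
apply: (le_trans (le_normr_Rintegral mcube fw)).
rewrite le_eqVlt; apply/orP; left; apply/eqP; apply: eq_Rintegral => y _.
by rewrite normrM walsh_tensor_norm mulr1.
Qed.

Lemma measurable_log_mean B f n : measurable_fun cube (log_mean B f n).
Proof.
apply: measurable_funM => //.
apply: (eq_measurable_fun (fun x => \sum_(i : {dffun forall j : 'I_d, 'I_(n j)})
    if [forall j, (0 < i j)%N] then
      rect_sum f (fun j => if j \in B then (n j - i j)%N else i j) x / \prod_(j < d) (i j)%:R
    else 0)); first by move=> x _; rewrite [RHS]big_mkcond.
apply: measurable_sum => i; case: [forall j, (0 < i j)%N] => //.
apply: measurable_funM => //; apply: measurable_sum => j.
by apply: measurable_funM => //; exact: measurable_walsh_tensor.
Qed.

(** The limit, being finite almost everywhere, is bounded by some [K0] outside a set of measure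
    below [e / 2], and eventually [F n] is within 1 of it outside another such set. *)
Lemma cvg_in_measure_tight (F : ('I_d -> nat) -> euclid R d -> R) (e : R) : 0 < e ->
  (forall n, measurable_fun cube (F n)) -> cvg_in_measure F ->
  exists K : nat, forall n, (forall i, (K <= n i)%N) ->
    (mu (cube `&` [set x | (K%:R < `|F n x|)%R]) <= e%:E)%E.
Proof.
move=> e0 mF [g [mg gfin /(_ 1 ltr01) Fg]].
have e20 : 0 < e / 2 by rewrite divr_gt0.
have nS : nbhs (0 : \bar R)%E [set y | (y < (e / 2)%:E)%E].
  by apply: open_nbhs_nbhs; split; [exact: open_ereal_lt_ereal|rewrite /= lte_fin].
have [M _ MP] := Fg _ nS.
have mlt (h : euclid R d -> \bar R) (c : R) : measurable_fun cube h ->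
    measurable (cube `&` [set x | (c%:E < `|h x|)%E]).
  move=> mh; rewrite (_ : [set x | _] = (abse \o h) @^-1` [set` `]c%:E, +oo[%O]).
    by apply: measurableT_comp => //; exact: emeasurable_itv.
  by apply/seteqP; split=> x /=; rewrite in_itv/= andbT.
have mF' n : measurable_fun cube (fun x => (F n x)%:E - g x)%E.
  by apply: emeasurable_funB => //; exact/measurable_EFinP.
pose A (k : nat) := cube `&` [set x | (k%:R%:E < `|g x|)%E].
have mA k : measurable (A k) by exact: mlt.
(* The sets [A k] decrease to the set where [g] is infinite, which is negligible. *)
have [K0 K0P] : exists K0, (mu (A K0) < (e / 2)%:E)%E.
  have mI : measurable (\bigcap_k A k) by exact: bigcapT_measurable.
  have A0 : mu (\bigcap_k A k) = 0%E.
    apply/negligibleP => //; apply: negligibleS gfin => x Ax /= /(_ _).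
    have [cx _] := Ax 0%N Logic.I; move=> /(_ cx) gx.
    have [N NP] : exists N : nat, (`|fine (g x)| <= N%:R)%R.
      by exists (Num.truncn `|fine (g x)|).+1; rewrite ltW// truncnS_gt.
    have [_ /=] := Ax N Logic.I.
    by rewrite -(fineK gx) /= lte_fin ltNge NP.
  have : (mu \o A) x @[x --> \oo] --> mu (\bigcap_k A k).
    apply: nonincreasing_cvg_mu => //.
      apply: (@le_lt_trans _ _ (mu cube)); last by rewrite lebesgue_unit_cube ltry.
      by apply: le_measure; rewrite ?inE//; move=> x [].
    move=> k l kl; apply/subsetPset => x [cx /= lx]; split=> //=.
    by apply: le_lt_trans lx; rewrite lee_fin ler_nat.
  rewrite A0 => /(_ _ nS)[K0 _ /(_ K0 (leqnn K0)) /= h].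
  by exists K0.
(* One integer serves both as threshold for the indices and as bound for the values, so that a
   single parameter indexes the later decomposition. *)
exists (maxn M K0.+1) => n nK.
have nM i : (M <= n i)%N by exact: leq_trans (leq_maxl _ _) (nK i).
apply: (@le_trans _ _ (mu ((cube `&` [set x | 1%:E < `|(F n x)%:E - g x|]%E) `|` A K0))).
  apply: le_measure; rewrite ?inE.
  - exact: (mlt (fun x => (F n x)%:E) (maxn M K0.+1)%:R (measurableT_comp _ (mF n))).
  - by apply: measurableU => //; exact: mlt.
  move=> x [cx /= lx]; have [gK|gK] := ltP (K0%:R%:E)%E `|g x|%E; first by right.
  left; split=> //=; have gx : g x \is a fin_num.
    by rewrite fin_num_abs (le_lt_trans gK)// ltry.
  move: gK; rewrite -(fineK gx) -EFinB !abse_EFin lee_fin lte_fin => gK.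
  have : (K0.+1%:R : R) <= (maxn M K0.+1)%:R by rewrite ler_nat leq_maxr.
  have H : `|F n x| <= `|fine (g x)| + `|F n x - fine (g x)|.
    by apply: le_trans (ler_normD _ _); rewrite addrC subrK.
  by rewrite -natr1; move: H lx gK; lra.
apply: le_trans (measureU2 _ _ _) _ => //; first exact: mlt.
by rewrite [e]splitr EFinD leeD// ltW//; exact: (MP n nM).
Qed.

End log_mean_operator.

(** * Choice of the height of the extremal functions *)

Section levels.
Context {R : realType} {d : nat} (B : {set 'I_d}) (Q : R -> R).
Hypothesis B1 : (1 < #|B|)%N.
Hypothesis hbig : forall C u0 : R,
  exists2 u, u0 <= u & C * Q u < LlogL (#|B| - 1)%:R u.

Lemma exists_height (V : nat) : exists u (L : nat),
  [/\ 0 < u, (0 < L)%N, 2 ^+ V <= u / 2 ^+ (L + 5 * #|B|) &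
      2 * Q u <= (#|compositions B L| * 2 ^ L)%:R].
Proof.
set k := #|B|; pose c0 := (5 * k + V)%N.
pose C : R := 2 * (2 ^+ c0.+1 * (2 * k%:R) ^+ k.-1).
(* The lower bound on [u] forces [p >= 2 * c0 + 2], hence [p.+2 <= 2 * L], which bounds the
   logarithm by [2 * L]. *)
have [u u0 uC] := hbig C (2 ^+ (2 * c0 + 2)).
have u1 : 1 <= u by apply: le_trans u0; rewrite exprn_ege1// ler1n.
have u_gt0 : 0 < u by exact: lt_le_trans u1.
pose p := trunc_log 2 (Num.truncn u).
have tu0 : (0 < Num.truncn u)%N by rewrite truncn_gt0.
have pl : 2 ^+ p <= u.
  apply: (@le_trans _ _ (Num.truncn u)%:R); last by rewrite truncn_le// ltW.
  by rewrite -natrX ler_nat trunc_logP.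
have pu : u < 2 ^+ p.+1.
  apply: lt_le_trans (truncnS_gt u) _.
  by rewrite -natrX ler_nat trunc_log_ltn.
have pc : (2 * c0 + 2 <= p)%N.
  by apply: trunc_log_max => //; rewrite truncn_ge_nat ?(ltW u_gt0)// natrX.
pose L := (p - c0)%N; have pE : p = (L + c0)%N by rewrite subnK//; lia.
exists u, L; split=> //; first by rewrite /L; lia.
  rewrite ler_pdivlMr ?exprn_gt0// -exprD; apply: le_trans pl.
  by rewrite ler_eXn2l// ?ltr1n// pE /c0; lia.
have k1 : (k - 1)%:R = k.-1%:R :> R by rewrite subn1.
have lnu : ln (1 + u) <= (2 * L)%:R.
  apply: (@le_trans _ _ (ln (2 ^+ p.+2))).
    rewrite ler_ln ?posrE ?exprn_gt0 ?addr_gt0// exprS.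
    have : 1 <= 2 ^+ p.+1 :> R by rewrite exprn_ege1// ler1n.
    by move: pu; lra.
  rewrite lnXn//; apply: (@le_trans _ _ (1 *+ p.+2)).
    rewrite ler_wMn2r//; have := @le_ln1Dx R 1; rewrite -[1 + 1]/2; apply; lra.
  by rewrite ler_nat pE /L; lia.
have ln0 : 0 <= ln (1 + u) by rewrite ln_ge0// lerDl ltW.
have Mu : LlogL (k - 1)%:R u <= 2 ^+ p.+1 * (2 * L)%:R ^+ k.-1.
  rewrite /LlogL k1 powR_mulrn ?(ger0_norm (ltW u_gt0))//.
  apply: ler_pM; [exact: ltW|exact: exprn_ge0|exact: ltW|].
  by apply: lerXn2r; rewrite ?nnegrE.
have NL : (L%:R : R) ^+ k.-1 <= k%:R ^+ k.-1 * #|compositions B L|%:R.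
  by rewrite -!natrX -natrM ler_nat card_compositions// ltnW.
have k0 : 0 < (2 * k%:R) ^+ k.-1 :> R by rewrite exprn_gt0// mulr_gt0// ltr0n ltnW.
have C20 : 0 < 2 ^+ c0.+1 * (2 * k%:R) ^+ k.-1 :> R by rewrite mulr_gt0// exprn_gt0.
rewrite -(ler_pM2l C20).
have -> : 2 ^+ c0.+1 * (2 * k%:R) ^+ k.-1 * (2 * Q u) = C * Q u by rewrite /C; ring.
apply: le_trans (ltW uC) _; apply: le_trans Mu _.
have -> : 2 ^+ p.+1 = 2 ^+ c0.+1 * 2 ^+ L :> R by rewrite -exprD pE addSn addnC.
rewrite -!mulrA ler_wpM2l ?exprn_ge0//.
rewrite !natrM natrX !exprMn [leRHS](_ : _ = 2 ^+ L * (2 ^+ k.-1 * (k%:R ^+ k.-1 * #|compositions B L|%:R))).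
  by rewrite !ler_wpM2l ?exprn_ge0.
by move: (2 ^+ k.-1) (k%:R ^+ k.-1) (#|_|%:R) (2 ^+ L) => a b c e; ring.
Qed.
End levels.

(** * Baire category *)

Section orlicz_baire.
Context {R : realType} {d : nat} (Q : R -> R).
Hypothesis hQ : young_function Q.
Local Notation mu := (lebesgue_tuple R d).
Local Notation cube := (unit_cube R d).
Implicit Types (f g h : orlicz d Q).

Let mcube := @measurable_unit_cube R d.

Let orlicz_int f : mu.-integrable cube (EFin \o f).
Proof. exact: orlicz_integrable (orlicz_funP f). Qed.

Definition L1_dist f g : R := \int[mu]_(x in cube) `|f x - g x|.

Lemma integrable_sub f g : mu.-integrable cube (EFin \o (fun x => f x - g x)).
Proof. exact: (@integrableB _ _ _ mu _ mcube _ _ (orlicz_int f) (orlicz_int g)). Qed.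

Lemma L1_dist_triangle f g h : L1_dist f h <= L1_dist f g + L1_dist g h.
Proof.
have ifg := integrable_norm (integrable_sub f g).
have igh := integrable_norm (integrable_sub g h).
have ifh := integrable_norm (integrable_sub f h).
rewrite /L1_dist -RintegralD//; apply: le_Rintegral => //.
  exact: (@integrableD _ _ _ mu _ mcube _ _ ifg igh).
move=> x _; apply: le_trans (ler_normD _ _).
by rewrite addrA subrK.
Qed.

(** The Luxemburg norm dominates the L1 norm up to the constant of [orlicz_L1], so the Orlicz
    topology is finer than that of L1. *)
Lemma nbhs_L1_ball f (r : R) : 0 < r -> nbhs f [set g | L1_dist g f < r].
Proof.
move=> r0; have [c c0 cP] := orlicz_L1 (d := d) hQ.
rewrite nbhsE; exists [set g | L1_dist g f < r] => //; split; last first.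
  by rewrite /= /L1_dist (eq_Rintegral _ (g := cst 0)) ?Rintegral_cst ?mul0r// => x _; rewrite subrr normr0.
move=> g /= gr; exists ((r - L1_dist g f) / c); first by rewrite divr_gt0// subr_gt0.
move=> g' /luxemburg_ltP[k kP]; rewrite lte_fin ltr_pdivlMr// => kr /=.
apply: le_lt_trans (L1_dist_triangle g' g f) _; rewrite -ltrBrDr.
apply: le_lt_trans kr; rewrite mulrC /L1_dist /Rintegral -lee_fin fineK; last first.
  by apply: (integrable_fin_num mcube); exact: (integrable_norm (integrable_sub g' g)).
apply: cP kP; apply/measurable_EFinP; exact: measurable_int (integrable_sub g' g).
Qed.

Lemma not_nowhere_dense_ball (A : set (orlicz d Q)) : ~ nowhere_dense A ->
  exists f, exists2 e : R, 0 < e & orlicz_ball f e `<=` closure A.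
Proof.
move=> /eqP/set0P[f]; rewrite /interior nbhsE => -[U [oU Uf] UA].
have [e e0 eU] : exists2 e : R, 0 < e & orlicz_ball f e `<=` U by exact: oU f Uf.
by exists f, e => // g /eU/UA.
Qed.
End orlicz_baire.

Lemma nowhere_dense_sub (T : topologicalType) (A A' : set T) :
  A `<=` A' -> nowhere_dense A' -> nowhere_dense A.
Proof.
move=> AA' nA'; apply/seteqP; split=> // x; rewrite -[set0]nA'.
by apply: filterS; exact: closure_subset.
Qed.

Theorem theorem6 (R : realType) (d : nat) (hd : (2 <= d)%N)
    (B : {set 'I_d}) (hB : (1 < #|B|)%N)
    (Q : R -> R) (hQ : young_function Q)
    (hL : ~ (orlicz_space d Q `<=` orlicz_space d (LlogL (#|B| - 1)%:R))) :
  first_category [set f : orlicz d Q | cvg_in_measure (log_mean B f)].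
Proof.
pose mu := lebesgue_tuple R d; pose cube := unit_cube R d.
pose big (c : R) f n := cube `&` [set x | (c < `|log_mean B f n x|)%R].
have mpre f n (i : interval R) :
    measurable (cube `&` [set x | `|log_mean B f n x| \in i]).
  have mf := measurableT_comp (@normr_measurable R setT) (@measurable_log_mean R d B f n).
  by apply: (mf _ [set` i]); [exact: measurable_unit_cube|exact: measurable_itv].
have mbig c f n : measurable (big c f n).
  have := mpre f n `]c, +oo[; rewrite (_ : [set x | _] = [set x | c < `|log_mean B f n x|])//.
  by apply/seteqP; split=> x /=; rewrite in_itv/= andbT.
(* The level 1/16 is small enough that two sets of this measure cannot cover a set of measure
   1/4. *)
pose G (K : nat) := [set f : orlicz d Q | forall n, (forall i, (K <= n i)%N) ->
  (mu (big K%:R f n) <= 16^-1%:E)%E].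
pose E := [set f : orlicz d Q | cvg_in_measure (log_mean B f)].
(* [first_category] asks for equality with the union, whereas [G K] alone need not lie in [E]; hence
   the intersection. *)
exists (fun K => E `&` G K); split; last first.
  apply/seteqP; split=> [f Ef|f [K _ []]//].
  have e16 : 0 < 16^-1 :> R by rewrite invr_gt0.
  have [K KP] := cvg_in_measure_tight e16 (measurable_log_mean B f) Ef.
  by exists K => //; split.
move=> K; apply: (@nowhere_dense_sub _ _ (G K)); first by move=> f [].
apply: contrapT => /not_nowhere_dense_ball[f0 [e e0 eG]].
(* [V] is chosen so that [e * 2 ^+ V] exceeds the sum of two bounds [K.+1]. *)
have [V VP] : exists V : nat, 2 * K.+1%:R < e * 2 ^+ V.
  exists (Num.truncn (2 * K.+1%:R / e)).+1; rewrite [e * _]mulrC -ltr_pdivrMr//.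
  apply: lt_trans (truncnS_gt _) _.
  by rewrite -natrX ltr_nat ltn_expl.
have [u [L [u0 L0 uV Qu]]] := exists_height hB (not_sub_LlogL hQ (ler0n _ _) hL) V.
(* The summand [3 * K] ensures [K <= 2 ^ m %/ 3], so that the definition of [G K] applies to [n]. *)
pose m := (18 * L + 38 + 3 * K)%N.
have Lm : (18 * L + 38 <= m)%N by exact: leq_addr.
have [F [FQ Fbig]] := exists_extremal_step (young0 hQ) u0 hB L0 Lm Qu.
pose n : 'I_d -> nat := fun=> (2 ^ m %/ 3)%N.
have nK i : (K <= n i)%N.
  by rewrite leq_divRL// (leq_trans _ (ltnW (ltn_expl m _)))// /m mulnC; lia.
pose xi (x : euclid R d) := F (cell m x).
have xi1 : modular_le1 Q 1 xi.
  split=> //; rewrite (eq_integral (fun x => (Q `|F (cell m x)|)%:E))//.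
  by move=> x _; rewrite divr1.
have xiO : orlicz_space d Q xi.
  by apply/orlicz_spaceP; split; [exact: measurable_step|exists 1].
have xii := orlicz_integrable hQ xiO.
have f0i := orlicz_integrable hQ (orlicz_funP f0).
(* Continuity of the single operator [L_n] transfers the bound defining [G K] to the
   points of its closure, at the cost of replacing [K] by [K.+1]. *)
have bound (s : R) : `|s| = 1 ->
    (mu (big K.+1%:R (fun x => 1 * f0 x + (s * (e / 2)) * xi x)%R n) <= 16^-1%:E)%E.
  move=> s1; have cO := orlicz_space_scale hQ (s * (e / 2)) xiO.
  have hO := orlicz_space_add hQ (orlicz_space_scale hQ 1 (orlicz_funP f0)) cO.
  pose h := Orlicz hO.
  have nc : `|s * (e / 2)| = e / 2 by rewrite normrM s1 mul1r gtr0_norm// divr_gt0.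
  have hball : orlicz_ball f0 e h.
    apply/luxemburg_ltP; exists (`|s * (e / 2)| * 1).
      rewrite [X in modular_le1 _ _ X](_ : _ = fun x => s * (e / 2) * xi x).
        by apply: modular_le1_scale => //; rewrite nc divr_gt0.
      by apply/funext => x /=; rewrite mul1r addrC addKr.
    by rewrite nc mulr1 lte_fin ltr_pdivrMr// ltr_pMr// ltr1n.
  have [C C0 CP] := @log_mean_bound R d B n.
  have C10 : 0 < C^-1 by rewrite invr_gt0.
  have [g [gG gh]] := eG _ hball _ (nbhs_L1_ball hQ h C10).
  apply: le_trans (gG n nK); apply: le_measure; rewrite ?inE//.
  move=> x [cx /= Lx]; split=> //=.
  have gi := orlicz_integrable hQ (orlicz_funP g).
  have hi := orlicz_integrable hQ (orlicz_funP h).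
  have close : `|log_mean B g n x - log_mean B h n x| <= 1.
    have := log_mean_linear B 1 (-1) n x gi hi; rewrite !mul1r mulN1r => <-.
    have ghi : mu.-integrable cube (EFin \o (fun x => 1 * g x + -1 * h x)).
      by under eq_fun do rewrite mul1r mulN1r; exact: integrable_sub.
    apply: le_trans (CP _ x ghi) _; rewrite -ler_pdivlMl// mulr1 ltW//.
    apply: le_lt_trans gh; rewrite le_eqVlt; apply/orP; left; apply/eqP.
    by apply: eq_Rintegral => y _; rewrite mul1r mulN1r.
  have H : `|log_mean B h n x| <= `|log_mean B g n x| + `|log_mean B g n x - log_mean B h n x|.
    by rewrite -[X in `|X| <= _](subKr (log_mean B g n x)) ler_normB.
  by move: Lx H close; rewrite -natr1 -/(orlicz_fun h); lra.
(* The means of [f0 + (e / 2) * xi] and [f0 - (e / 2) * xi] differ by [e] times the mean of [xi].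
   Where the latter is at least [2 ^+ V] in absolute value, one of the former must exceed [K.+1], so
   the set of measure 1/4 lies in two sets of measure at most 1/16. *)
have bp := bound 1 (normr1 _); have bm := bound (-1) (normrN1 _).
suff : (4^-1%:E <= 16^-1%:E + 16^-1%:E :> \bar R)%E.
  by rewrite -EFinD lee_fin; lra.
apply: le_trans Fbig _; apply: le_trans (leeD bp bm).
apply: le_trans (measureU2 _ _ _) => //; apply: le_measure; rewrite ?inE.
- have := mpre xi n `[u / 2 ^+ (L + 5 * #|B|), +oo[.
  rewrite (_ : [set x | _] = [set x | u / 2 ^+ (L + 5 * #|B|) <= `|log_mean B xi n x|])//.
  by apply/seteqP; split=> x /=; rewrite in_itv/= andbT.
- exact: measurableU.
move=> x [cx /= Lx].
have Vx : 2 ^+ V <= `|log_mean B xi n x| by exact: le_trans uV Lx.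
have := log_mean_linear B 1 (1 * (e / 2)) n x f0i xii.
have := log_mean_linear B 1 (-1 * (e / 2)) n x f0i xii.
move=> Em Ep.
have [lt|le] := ltP K.+1%:R `|log_mean B (fun x => 1 * f0 x + 1 * (e / 2) * xi x) n x|.
  by left.
right; split=> //=; rewrite ltNge; apply/negP => le'.
move: le le'; rewrite Ep Em !mul1r mulN1r; set a := log_mean B f0 n x => le le'.
have : `|e * log_mean B xi n x| <= K.+1%:R + K.+1%:R.
  apply: le_trans (lerD le le'); apply: le_trans (ler_normB _ _).
  by rewrite le_eqVlt; apply/orP; left; apply/eqP; congr `|_|; field.
rewrite normrM gtr0_norm// => le2.
have : e * 2 ^+ V <= e * `|log_mean B xi n x| by rewrite ler_pM2l.
by move: VP le2; lra.
Qed.
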